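(* Let $\Omega=[a,b]^\nu\subset\mathbb{R}^\nu$, $\mathcal{H}=L_2(\Omega\times\Omega)$, $k\in C(\Omega^3)$, and $(T_1f)(x,y)=\int_\Omega k(x,s,y)f(s,y)\,ds$ for $f\in\mathcal{H}$. Let $\varkappa_0\in\mathcal{E}_{T_1}$ be an essential number. If $g_0\in\mathcal{H}$ satisfies $$\int_\Omega\frac{\int_\Omega|g_0(s,y)|^2\,ds}{|D_1(y;\varkappa_0)|^2}\,dy<\infty,$$ then the equation $f-\varkappa_0T_1f=g_0$ has a unique solution in $\mathcal{H}$, and it has the form $f=g_0+\varkappa_0Bg_0\in\mathcal{H}$, where $$(Bg)(x,y)=\int_\Omega\frac{M_1(x,s,y;\varkappa_0)}{D_1(y;\varkappa_0)}\,g(s,y)\,ds;$$ moreover, the corresponding homogeneous equation $f-\varkappa_0T_1f=0$ has only the trivial solution in $\mathcal{H}$.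
   Context: Here $a<b$ are reals, $\nu\ge 1$ is an integer, $\mu$ is Lebesgue measure on $\Omega$, $E$ is the identity operator, and $L_2$ spaces are complex. For $k\in C(\Omega^3)$ (complex-valued) and $y\in\Omega$, let $K_y$ be the compact operator on $L_2(\Omega)$ given by $(K_y\varphi)(x)=\int_\Omega k(x,s,y)\varphi(s)\,ds$. For $\varkappa\in\mathbb{C}$, the determinant $D_1(y;\varkappa)$ and the minor $M_1(x,s,y;\varkappa)$ of $E-\varkappa T_1$ are defined, for each fixed $y$, as the classical Fredholm determinant and Fredholm (first) minor of $E-\varkappa K_y$: $$D_1(y;\varkappa)=1+\sum_{n=1}^\infty\frac{(-\varkappa)^n}{n!}\int_{\Omega^n}\det\big(k(\xi_i,\xi_j,y)\big)_{i,j=1}^n\,d\xi_1\cdots d\xi_n,$$ $$M_1(x,s,y;\varkappa)=k(x,s,y)+\sum_{n=1}^\infty\frac{(-\varkappa)^n}{n!}\int_{\Omega^n}\det\big(k(u_i,v_j,y)\big)_{i,j=0}^{n}\,d\xi_1\cdots d\xi_n,$$ where $u_0=x$, $v_0=s$, and $u_i=v_i=\xi_i$ for $i\ge1$. For each $\varkappa$ they are continuous functions on $\Omega$ and on $\Omega^3$, respectively. Definitions: $\varkappa_0\in\mathbb{C}$ is a singular number if $D_1(y_0;\varkappa_0)=0$ for some $y_0\in\Omega$ (set $\mathcal{S}_{T_1}$); a characteristic number if there is a measurable $\Omega_0\subset\Omega$ with $\mu(\Omega_0)>0$ and $D_1(y;\varkappa_0)=0$ for all $y\in\Omega_0$ (set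 $\mathcal{X}_{T_1}$); an essential number if $\varkappa_0\in\mathcal{E}_{T_1}:=\mathcal{S}_{T_1}\setminus\mathcal{X}_{T_1}$. Thus for $\varkappa_0\in\mathcal{E}_{T_1}$ the zero set of $D_1(\cdot;\varkappa_0)$ is nonempty and has measure zero, and the quotients by $D_1(y;\varkappa_0)$ above are understood for almost every $y$. *)

(* Defs.v *)
From HB Require Import structures.
From mathcomp Require Import all_boot all_order all_algebra.
From mathcomp Require Import all_classical all_reals all_analysis.
From mathcomp Require Import complex.

Set Implicit Arguments.
Unset Strict Implicit.
Unset Printing Implicit Defensive.

Import Order.TTheory GRing.Theory Num.Theory numFieldNormedType.Exports.

Local Open Scope classical_set_scope.
Local Open Scope ring_scope.
Local Open Scope complex_scope.

Section pushforward_cancel.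
Local Open Scope ereal_scope.
Context d d' (T : measurableType d) (T' : measurableType d') (R : realType).
Variable m : {measure set T -> \bar R}.
Hypothesis sm : sigma_finite setT m.
Variables (f : T -> T') (g : T' -> T).
Hypotheses (mf : measurable_fun setT f) (mg : measurable_fun setT g).
Hypothesis fK : cancel f g.

Let mpre A : measurable A -> measurable (f @^-1` A).
Proof. by move=> mA; rewrite -[X in measurable X]setTI; exact: mf. Qed.

Let push : set T' -> \bar R := pushforward m f.

Let push0 : push set0 = 0.
Proof. by rewrite /push /pushforward preimage_set0 measure0. Qed.

Let push_ge0 A : 0 <= push A.
Proof. exact: measure_ge0. Qed.

Let push_sigma_additive : semi_sigma_additive push.
Proof.
move=> F mF tF mUF; rewrite /push /pushforward preimage_bigcup.
apply: measure_semi_sigma_additive.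
- by move=> n; exact: mpre.
- apply/trivIsetP => /= i j _ _ ij; rewrite -preimage_setI.
  by move/trivIsetP : tF => /(_ _ _ _ _ ij) ->//; rewrite preimage_set0.
- by rewrite -preimage_bigcup; exact: mpre.
Qed.

HB.instance Definition _ :=
  isMeasure.Build _ _ _ push push0 push_ge0 push_sigma_additive.

Let push_sigma_finite : sigma_finite setT push.
Proof.
have [F TF Foo] := sm.
exists (fun i => g @^-1` F i).
  by rewrite -preimage_bigcup -TF preimage_setT.
move=> i; have [mFi Fioo] := Foo i; split.
  by rewrite -[X in measurable X]setTI; exact: mg.
rewrite /push /pushforward -comp_preimage (_ : g \o f = id) ?preimage_id//.
by apply/funext => x /=; rewrite fK.
Qed.

HB.instance Definition _ :=
  Measure_isSigmaFinite.Build _ _ _ push push_sigma_finite.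

Lemma pushforward_cancel_sigma_finite :
  exists m' : {sigma_finite_measure set T' -> \bar R},
    pushforward m f = m' :> (set T' -> \bar R).
Proof. by exists push. Qed.

End pushforward_cancel.

(* The sigma-finiteness instance declared by the library for [m1 \x m2] is not
   found by inference, hence this restatement. *)
Lemma product_measure_sigma_finite d1 d2 (T1 : measurableType d1)
    (T2 : measurableType d2) (R : realType)
    (m1 : {sigma_finite_measure set T1 -> \bar R})
    (m2 : {sigma_finite_measure set T2 -> \bar R}) :
  sigma_finite setT (m1 \x m2)%E.
Proof.
have /sigma_finiteP[F [TF ndF Foo]] := sigma_finiteT m1.
have /sigma_finiteP[G [TG ndG Goo]] := sigma_finiteT m2.
exists (fun n => F n `*` G n).
  rewrite -setXTT TF TG predeqE => -[x y]; split.
    move=> [/= [n _ Fnx] [k _ Gky]]; exists (maxn n k) => //; split.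
    - by move: x Fnx; exact/subsetPset/ndF/leq_maxl.
    - by move: y Gky; exact/subsetPset/ndG/leq_maxr.
  by move=> [n _ []/= ? ?]; split; exists n.
move=> k; have [? ?] := Foo k; have [? ?] := Goo k.
split; first exact: measurableX.
by rewrite product_measure1E// lte_mul_pinfty// ge0_fin_numE.
Qed.

(* The [n]-fold product of [mu], as a measure on [n.-tuple T]. *)
Section tuple_measure.
Context d (T : measurableType d) (R : realType).
Local Open Scope ereal_scope.

Fixpoint tuple_measure (mu : set T -> \bar R) n : set (n.-tuple T) -> \bar R :=
  if n is n'.+1 then
    pushforward (mu \x @tuple_measure mu n')
                (fun p => [tuple of p.1 :: p.2])
  else \d_([tuple] : 0.-tuple T).

Arguments tuple_measure : clear implicits.

Variable mu : {sigma_finite_measure set T -> \bar R}.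

Lemma tuple_measure_sigma_finite_measure n :
  exists m : {sigma_finite_measure set (n.-tuple T) -> \bar R},
    tuple_measure mu n = m :> (set _ -> \bar R).
Proof.
elim: n => [|n [m mE]] /=; first by exists \d_[tuple].
rewrite mE.
apply: (pushforward_cancel_sigma_finite (product_measure_sigma_finite mu m)
  (g := fun t : n.+1.-tuple T => (thead t, [tuple of behead t]))).
- exact: measurable_cons.
- apply/measurable_fun_pair => /=; first exact: measurable_tnth.
  exact: measurable_behead.
- by case=> x t; congr pair; apply: val_inj.
Qed.

Let tuple_measure0 n : tuple_measure mu n set0 = 0.
Proof. by have [m ->] := tuple_measure_sigma_finite_measure n. Qed.

Let tuple_measure_ge0 n A : 0 <= tuple_measure mu n A.
Proof. by have [m ->] := tuple_measure_sigma_finite_measure n. Qed.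

Let tuple_measure_sigma_additive n : semi_sigma_additive (tuple_measure mu n).
Proof.
have [m ->] := tuple_measure_sigma_finite_measure n.
exact: measure_semi_sigma_additive.
Qed.

HB.instance Definition _ n := isMeasure.Build _ _ _ (tuple_measure mu n)
  (@tuple_measure0 n) (@tuple_measure_ge0 n) (@tuple_measure_sigma_additive n).

Let tuple_measure_sigma_finite n : sigma_finite setT (tuple_measure mu n).
Proof.
have [m ->] := tuple_measure_sigma_finite_measure n.
exact: sigma_finiteT.
Qed.

HB.instance Definition _ n := Measure_isSigmaFinite.Build _ _ _
  (tuple_measure mu n) (@tuple_measure_sigma_finite n).

End tuple_measure.
Arguments tuple_measure {d T R} mu n _.

(* Borel sets of [R^n], generated by the coordinates. *)
Section measurable_rV.
Variables (R : realType) (n : nat).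

Let coord (i : 'I_n) (x : 'rV[R]_n) : measurableTypeR R := x ord0 i.

Let rV_set0 : g_sigma_preimage coord set0.
Proof. exact: sigma_algebra0. Qed.

Let rV_setC A : g_sigma_preimage coord A -> g_sigma_preimage coord (~` A).
Proof. exact: sigma_algebraC. Qed.

Let rV_bigcup (F : (set 'rV[R]_n)^nat) : (forall i, g_sigma_preimage coord (F i)) ->
  g_sigma_preimage coord (\bigcup_i (F i)).
Proof. exact: sigma_algebra_bigcup. Qed.

HB.instance Definition _ := @isMeasurable.Build default_measure_display
  'rV[R]_n (g_sigma_preimage coord) rV_set0 rV_setC rV_bigcup.

Lemma measurable_rV_coord (i : 'I_n) :
  measurable_fun setT (fun x : 'rV[R]_n => x ord0 i : measurableTypeR R).
Proof.
move=> _ Y mY; rewrite setTI; apply: sub_sigma_algebra => /=.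
rewrite -bigcup_seq/=; exists i => /=; first by rewrite mem_index_enum.
by exists Y => //; rewrite setTI.
Qed.

Lemma measurable_fun_rVP d (T : measurableType d) (f : T -> 'rV[R]_n) :
  (forall i, measurable_fun setT (fun x => f x ord0 i : measurableTypeR R)) ->
  measurable_fun setT f.
Proof.
move=> mf; apply: (measurability _ (erefl (g_sigma_preimage coord))).
move=> _ [B GB <-].
have : (\bigcup_(i in [set` index_enum 'I_n])
    preimage_set_system setT (coord i) measurable) B by rewrite bigcup_seq.
by move=> [i _ [C mC <-]]; rewrite setTI -comp_preimage; exact: mf.
Qed.

End measurable_rV.

(* Lebesgue measure on the Borel sets of [R^n]. *)
Section lebesgue_rV.
Variables (R : realType) (n : nat).
Local Open Scope ereal_scope.

Let row_of_tuple (t : n.-tuple (measurableTypeR R)) : 'rV[R]_n :=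
  \row_i tnth t i.

Definition lebesgue_rV : set 'rV[R]_n -> \bar R :=
  pushforward (tuple_measure (@lebesgue_measure R) n)
              row_of_tuple.

Lemma lebesgue_rV_sigma_finite_measure :
  exists m : {sigma_finite_measure set 'rV[R]_n -> \bar R},
    lebesgue_rV = m :> (set _ -> \bar R).
Proof.
apply: (@pushforward_cancel_sigma_finite _ _ _ _ _ _ _ row_of_tuple
  (fun x : 'rV[R]_n => [tuple (x ord0 i : measurableTypeR R) | i < n])).
- exact: sigma_finiteT.
- apply: measurable_fun_rVP => i.
  rewrite (_ : (fun _ => _) = (@tnth _ (measurableTypeR R))^~ i).
    exact: measurable_tnth.
  by apply/funext => t; rewrite mxE.
- apply/measurable_fun_tnthP => i.
  rewrite (_ : _ \o _ = fun x : 'rV[R]_n => x ord0 i : measurableTypeR R).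
    exact: measurable_rV_coord.
  by apply/funext => x /=; rewrite tnth_mktuple.
- by move=> t; apply: eq_from_tnth => i; rewrite tnth_mktuple mxE.
Qed.

Let lebesgue_rV0 : lebesgue_rV set0 = 0.
Proof. by have [m ->] := lebesgue_rV_sigma_finite_measure. Qed.

Let lebesgue_rV_ge0 A : 0 <= lebesgue_rV A.
Proof. by have [m ->] := lebesgue_rV_sigma_finite_measure. Qed.

Let lebesgue_rV_sigma_additive : semi_sigma_additive lebesgue_rV.
Proof.
have [m ->] := lebesgue_rV_sigma_finite_measure.
exact: measure_semi_sigma_additive.
Qed.

HB.instance Definition _ := isMeasure.Build _ _ _ lebesgue_rV
  lebesgue_rV0 lebesgue_rV_ge0 lebesgue_rV_sigma_additive.

Let lebesgue_rV_sigma_finite : sigma_finite setT lebesgue_rV.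
Proof.
have [m ->] := lebesgue_rV_sigma_finite_measure.
exact: sigma_finiteT.
Qed.

HB.instance Definition _ := Measure_isSigmaFinite.Build _ _ _
  lebesgue_rV lebesgue_rV_sigma_finite.

End lebesgue_rV.
Arguments lebesgue_rV {R n}.

Definition cube (R : realType) (n : nat) (a b : R) : set 'rV[R]_n :=
  [set x | forall i, a <= x ord0 i <= b].
Arguments cube {R} n a b.

Section complex_integral.
Context d (T : measurableType d) (R : realType).
Implicit Types (D : set T) (f : T -> R[i]).

Definition cmeasurable_fun D f :=
  measurable_fun D (fun x => complex.Re (f x)) /\
  measurable_fun D (fun x => complex.Im (f x)).

Definition cintegral (mu : {measure set T -> \bar R}) D f : R[i] :=
  (\int[mu]_(x in D) complex.Re (f x)) +i* (\int[mu]_(x in D) complex.Im (f x)).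

Definition sqnorm (z : R[i]) : \bar R := (Normc.normc z ^+ 2)%:E.

(* The elements are functions, of which only the restriction to [D] matters, and
   not classes: equalities between them are to be stated almost everywhere. *)
Definition L2 (mu : {measure set T -> \bar R}) D : set (T -> R[i]) :=
  [set f | cmeasurable_fun D f /\ (\int[mu]_(x in D) sqnorm (f x) < +oo)%E].

End complex_integral.

Section fredholm.
Context d (T : measurableType d) (R : realType).
Variables (mu : {sigma_finite_measure set T -> \bar R}) (D : set T).
Variable K : T -> T -> R[i].

Definition tuple_set n : set (n.-tuple T) := [set t | forall i, D (tnth t i)].

(* [C^o] carries the topology of [C] given by its norm. *)
Definition fredholm_det (kappa : R[i]) : R[i] :=
  1 + limn (fun N => \sum_(1 <= n < N)
    (- kappa) ^+ n / n`!%:R * cintegral (tuple_measure mu n) (@tuple_set n)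
      (fun xi => \det (\matrix_(i < n, j < n) K (tnth xi i) (tnth xi j)))
    : R[i]^o).

Definition fredholm_minor (x s : T) (kappa : R[i]) : R[i] :=
  K x s + limn (fun N => \sum_(1 <= n < N)
    (- kappa) ^+ n / n`!%:R * cintegral (tuple_measure mu n) (@tuple_set n)
      (fun xi => \det (\matrix_(i < n.+1, j < n.+1)
         K (tnth [tuple of x :: xi] i) (tnth [tuple of s :: xi] j)))
    : R[i]^o).

End fredholm.

Section partial_integral_operator.
Variables (R : realType) (nu : nat) (a b : R).
Local Notation C := R[i].
Local Notation Rnu := 'rV[R]_nu.
Local Notation Omega := (cube nu a b).
Local Notation lambda := (@lebesgue_rV R nu).

(* Only the values of [k] on [Omega ^ 3] matter. *)
Variable k : Rnu -> Rnu -> Rnu -> C.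

Definition continuous_kernel :=
  {within Omega `*` Omega `*` Omega,
    continuous ((fun p => k p.1.1 p.1.2 p.2) : Rnu * Rnu * Rnu -> C^o)}.

Definition inH : set (Rnu * Rnu -> C) :=
  L2 (lambda \x lambda)%E (Omega `*` Omega).

Definition ae_eqH (f g : Rnu * Rnu -> C) :=
  {ae (lambda \x lambda)%E, forall p, (Omega `*` Omega) p -> f p = g p}.

Definition T1 (f : Rnu * Rnu -> C) (p : Rnu * Rnu) : C :=
  cintegral lambda Omega (fun s => k p.1 s p.2 * f (s, p.2)).

Definition D1 (y : Rnu) (kappa : C) : C :=
  fredholm_det lambda Omega (fun x s => k x s y) kappa.

Definition M1 (x s y : Rnu) (kappa : C) : C :=
  fredholm_minor lambda Omega (fun x s => k x s y) x s kappa.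

Definition singular_numbers : set C :=
  [set kappa | exists2 y0, Omega y0 & D1 y0 kappa = 0].

Definition characteristic_numbers : set C :=
  [set kappa | exists Omega0 : set Rnu,
    [/\ measurable Omega0, Omega0 `<=` Omega, (0 < lambda Omega0)%E &
        forall y, Omega0 y -> D1 y kappa = 0]].

Definition essential_numbers : set C :=
  singular_numbers `\` characteristic_numbers.

Definition resolvent_op (kappa : C) (g : Rnu * Rnu -> C) (p : Rnu * Rnu) : C :=
  cintegral lambda Omega
    (fun s => M1 p.1 s p.2 kappa / D1 p.2 kappa * g (s, p.2)).

Definition is_solution (kappa : C) (g f : Rnu * Rnu -> C) :=
  inH f /\ ae_eqH (fun p => f p - kappa * T1 f p) g.

End partial_integral_operator.

(* Main.v *)
(** For fixed [y], expanding the bordered determinants of the Fredholm series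
    along their first row and integrating gives Fredholm's relation
    [M = D k + kappa k*M] between the determinant [D] and the minor [M], and
    transposing the kernel gives [M = D k + kappa M*k].  So wherever [D] does not
    vanish, [E + kappa M/D] is a two-sided inverse of [E - kappa K_y] on [L_1],
    which contains [L_2] since [Omega] has finite measure.  As [kappa0] is not
    characteristic, this covers almost every [y].  The minor is bounded (by
    Hadamard's inequality), so by Cauchy-Schwarz [|(B g)(x, y)|^2] is at most a
    constant times the integral of [|g(., y)|^2] divided by [|D(y)|^2], which
    puts [B g0] in [L_2].

    Continuity of [k] serves only to make it bounded and measurable: the argument
    is carried out for bounded measurable kernels on a finite measure space, and
    applied to Lebesgue measure restricted to the cube, with [k] and [g0] extended
    by zero. *)

Require Import Defs.
From mathcomp Require Import all_boot all_order all_algebra.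
From mathcomp Require Import all_classical all_reals all_analysis.
From mathcomp Require Import perm measurable_realfun complex ring lra.

Set Implicit Arguments.
Unset Strict Implicit.
Unset Printing Implicit Defensive.

Import Order.TTheory GRing.Theory Num.Theory numFieldNormedType.Exports.

Local Open Scope classical_set_scope.
Local Open Scope ring_scope.
Local Open Scope complex_scope.

(** Integrating the row expansion is the delicate point. The measure on tuples is built by
    prepending a coordinate, whereas the expansion singles out the [j]-th one; so its symmetry has
    to be proved, in the form that splitting off any coordinate yields the product of the base
    measure and the shorter tuple measure. All terms of the expansion then have the same integral,
    and their number [n.+1] reduces (n+1)! to n!, which turns a relation between coefficients into
    one between series. Hadamard's inequality does more than bound the minor: the trivial bound n!
    M^n on determinants would give convergence for small [kappa] only, and uniformity in all points
    is what permits the limit under the integral. The unknowns are functions on a product, so good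
    sections in [y] are obtained by Tonelli for almost every [y] only, and what is shown on sections
    has to be reassembled on the product. The sigma-algebra on triples of points is generated by
    coordinates and products, not by open sets, so measurability of a continuous kernel is proved by
    approximation on grids. *)

Local Notation Re := complex.Re.
Local Notation Im := complex.Im.
Local Notation normc := Normc.normc.

(** * Integration of complex-valued functions *)

Section complex_parts.
Context {R : realType}.
Implicit Types x y : R[i].

Lemma ReD x y : Re (x + y) = Re x + Re y. Proof. by case: x; case: y. Qed.
Lemma ImD x y : Im (x + y) = Im x + Im y. Proof. by case: x; case: y. Qed.
Lemma ReN x : Re (- x) = - Re x. Proof. by case: x. Qed.
Lemma ImN x : Im (- x) = - Im x. Proof. by case: x. Qed.
Lemma ReB x y : Re (x - y) = Re x - Re y. Proof. by rewrite ReD ReN. Qed.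
Lemma ImB x y : Im (x - y) = Im x - Im y. Proof. by rewrite ImD ImN. Qed.
Lemma ReM x y : Re (x * y) = Re x * Re y - Im x * Im y.
Proof. by case: x; case: y. Qed.
Lemma ImM x y : Im (x * y) = Re x * Im y + Im x * Re y.
Proof. by case: x => a b; case: y => c d. Qed.

Lemma complexP x y : Re x = Re y -> Im x = Im y -> x = y.
Proof. by case: x => a b; case: y => c d /= -> ->. Qed.

Lemma normc_ge0 x : 0 <= normc x.
Proof. by case: x => a b; exact: sqrtr_ge0. Qed.

Lemma sqr_normcE x : normc x ^+ 2 = Re x ^+ 2 + Im x ^+ 2.
Proof. by case: x => a b /=; rewrite sqr_sqrtr// addr_ge0// sqr_ge0. Qed.

Lemma normr_Re_le x : `|Re x| <= normc x.
Proof.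
by rewrite -(@ler_pXn2r _ 2)// ?nnegrE ?normc_ge0// sqr_normcE real_normK ?num_real//
  lerDl sqr_ge0.
Qed.

Lemma normr_Im_le x : `|Im x| <= normc x.
Proof.
by rewrite -(@ler_pXn2r _ 2)// ?nnegrE ?normc_ge0// sqr_normcE real_normK ?num_real//
  lerDr sqr_ge0.
Qed.

Lemma normc_le_ReIm x : normc x <= `|Re x| + `|Im x|.
Proof.
rewrite -(@ler_pXn2r _ 2)// ?nnegrE ?normc_ge0 ?addr_ge0// sqr_normcE sqrrD.
by rewrite !real_normK ?num_real// addrAC lerDl mulrn_wge0// mulr_ge0.
Qed.

Lemma normcC x : `|x| = (normc x)%:C. Proof. by case: x. Qed.

Lemma normc_eq0 x : (normc x == 0) = (x == 0).
Proof.
apply/eqP/eqP => [|->]; first exact: Normc.eq0_normc.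
by rewrite Normc.normc0.
Qed.

Lemma normc_le_sum I (r : seq I) (P : pred I) (F : I -> R[i]) :
  normc (\sum_(i <- r | P i) F i) <= \sum_(i <- r | P i) normc (F i).
Proof.
elim/big_rec2 : _ => [|i y x _ h]; first by rewrite Normc.normc0.
by rewrite (le_trans (le_normcD _ _))// lerD2l.
Qed.

End complex_parts.

(** The inverse is continuous off [0], and the remaining point is a measurable singleton. *)
Lemma measurable_invr (R : realType) : measurable_fun setT (@GRing.inv R).
Proof.
have -> : setT = [set x : R | x != 0] `|` [set 0].
  apply/seteqP; split=> x // _; have [->|x0] := eqVneq x 0; first by right.
  by left.
have mN0 : measurable [set x : R | x != 0] by apply: open_measurable; exact: open_neq.
apply/measurable_funU => //.
split; last exact: measurable_fun_set1.
apply: open_continuous_measurable_fun => [|x].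
  exact: open_neq.
by rewrite inE/= => x0; exact: inv_continuous.
Qed.

Section cmeasurable.
Context d (T : measurableType d) (R : realType).
Implicit Types f g : T -> R[i].

Lemma cmeasurable_cst (c : R[i]) : cmeasurable_fun setT (fun _ : T => c).
Proof. by split; exact: measurable_cst. Qed.

Lemma cmeasurableD f g : cmeasurable_fun setT f -> cmeasurable_fun setT g ->
  cmeasurable_fun setT (fun x => f x + g x).
Proof.
move=> [f1 f2] [g1 g2]; split.
  by under eq_fun do rewrite ReD; exact: measurable_funD.
by under eq_fun do rewrite ImD; exact: measurable_funD.
Qed.

Lemma cmeasurableN f : cmeasurable_fun setT f ->
  cmeasurable_fun setT (fun x => - f x).
Proof.
move=> [f1 f2]; split.
  by under eq_fun do rewrite ReN; exact: measurableT_comp.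
by under eq_fun do rewrite ImN; exact: measurableT_comp.
Qed.

Lemma cmeasurableM f g : cmeasurable_fun setT f -> cmeasurable_fun setT g ->
  cmeasurable_fun setT (fun x => f x * g x).
Proof.
move=> [f1 f2] [g1 g2]; split.
  by under eq_fun do rewrite ReM; apply: measurable_funB; exact: measurable_funM.
by under eq_fun do rewrite ImM; apply: measurable_funD; exact: measurable_funM.
Qed.

Lemma cmeasurable_sum I (r : seq I) (P : pred I) (F : I -> T -> R[i]) :
  (forall i, cmeasurable_fun setT (F i)) ->
  cmeasurable_fun setT (fun x => \sum_(i <- r | P i) F i x).
Proof.
move=> mF; elim: r => [|i r ih].
  by under eq_fun do rewrite big_nil; exact: cmeasurable_cst.
under eq_fun do rewrite big_cons; case: (P i) => //.
exact: cmeasurableD.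
Qed.

Lemma cmeasurable_prod I (r : seq I) (P : pred I) (F : I -> T -> R[i]) :
  (forall i, cmeasurable_fun setT (F i)) ->
  cmeasurable_fun setT (fun x => \prod_(i <- r | P i) F i x).
Proof.
move=> mF; elim: r => [|i r ih].
  by under eq_fun do rewrite big_nil; exact: cmeasurable_cst.
under eq_fun do rewrite big_cons; case: (P i) => //.
exact: cmeasurableM.
Qed.

Lemma cmeasurable_det n (A : T -> 'M[R[i]]_n) :
  (forall i j, cmeasurable_fun setT (fun x => A x i j)) ->
  cmeasurable_fun setT (fun x => \det (A x)).
Proof.
move=> mA; apply: cmeasurable_sum => s; apply: cmeasurableM.
  exact: cmeasurable_cst.
exact: cmeasurable_prod.
Qed.

Lemma measurable_sqr_normc f : cmeasurable_fun setT f ->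
  measurable_fun setT (fun x => normc (f x) ^+ 2).
Proof.
move=> [f1 f2]; under eq_fun do rewrite sqr_normcE.
by apply: measurable_funD; exact: measurable_funX.
Qed.

Lemma measurable_normc f : cmeasurable_fun setT f ->
  measurable_fun setT (fun x => normc (f x)).
Proof.
move=> /measurable_sqr_normc mf.
rewrite (_ : (fun _ => _) = Num.sqrt \o (fun x => normc (f x) ^+ 2)); last first.
  by apply/funext => x /=; rewrite sqrtr_sqr ger0_norm// normc_ge0.
apply: measurableT_comp => //.
exact: continuous_measurable_fun (@sqrt_continuous R).
Qed.

(** The inverse is the conjugate over the squared modulus, also at [0], so the real inverse
    suffices. *)
Lemma cmeasurableV f : cmeasurable_fun setT f ->
  cmeasurable_fun setT (fun x => (f x)^-1).
Proof.
move=> mf; have [f1 f2] := mf; have mn := measurable_sqr_normc mf.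
have mV : measurable_fun setT (fun x => (normc (f x) ^+ 2)^-1).
  exact: measurableT_comp (@measurable_invr R) _.
split.
- rewrite (_ : (fun _ => _) = (fun x => Re (f x) * (normc (f x) ^+ 2)^-1)).
    exact: measurable_funM.
  by apply/funext => x; rewrite sqr_normcE; case: (f x).
- rewrite (_ : (fun _ => _) = (fun x => - Im (f x) * (normc (f x) ^+ 2)^-1)).
    by apply: measurable_funM => //; exact: measurableT_comp.
  by apply/funext => x; rewrite sqr_normcE; case: (f x) => a b /=; rewrite mulNr.
Qed.

End cmeasurable.

Lemma cmeasurable_comp d d' (T : measurableType d) (T' : measurableType d')
    (R : realType) (f : T' -> R[i]) (g : T -> T') :
  cmeasurable_fun setT f -> measurable_fun setT g ->
  cmeasurable_fun setT (fun x => f (g x)).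
Proof.
by move=> [f1 f2] mg; split; [exact: (measurableT_comp f1 mg)|exact: (measurableT_comp f2 mg)].
Qed.

Section complex_integrable.
Context d (T : measurableType d) (R : realType) (mu : {measure set T -> \bar R}).
Implicit Types f g : T -> R[i].

Definition cintegrable f :=
  mu.-integrable setT (EFin \o (fun x => Re (f x))) /\
  mu.-integrable setT (EFin \o (fun x => Im (f x))).

Lemma cintegrable_measurable f : cintegrable f -> cmeasurable_fun setT f.
Proof.
by move=> [/measurable_int/measurable_EFinP ? /measurable_int/measurable_EFinP ?].
Qed.

Lemma le_cintegrable f (g : T -> R) : cmeasurable_fun setT f ->
  mu.-integrable setT (EFin \o g) -> (forall x, normc (f x) <= g x) ->
  cintegrable f.
Proof.
move=> [f1 f2] ig fg; split; apply: le_integrable ig => //.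
- exact/measurable_EFinP.
- move=> x _; rewrite /= lee_fin (le_trans (normr_Re_le _))//.
  by rewrite (le_trans (fg x))// ler_norm.
- exact/measurable_EFinP.
- move=> x _; rewrite /= lee_fin (le_trans (normr_Im_le _))//.
  by rewrite (le_trans (fg x))// ler_norm.
Qed.

Lemma cintegrable_normc f : cintegrable f ->
  mu.-integrable setT (EFin \o (fun x => normc (f x))).
Proof.
move=> intf; have mf := cintegrable_measurable intf; case: intf => f1 f2.
have h := integrableD measurableT (integrable_norm f1) (integrable_norm f2).
apply: le_integrable h => //; first exact/measurable_EFinP/measurable_normc.
move=> x _; rewrite /= lee_fin ger0_norm ?normc_ge0//.
by rewrite (le_trans (normc_le_ReIm _))// ler_norm.
Qed.

Lemma cintegrableMl (h : T -> R[i]) f M : cmeasurable_fun setT h ->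
  (forall x, normc (h x) <= M) -> cintegrable f ->
  cintegrable (fun x => h x * f x).
Proof.
move=> mh hM intf.
have := cintegrable_normc intf => /(integrableZl measurableT M) intn.
apply: (@le_cintegrable _ (fun x => M * normc (f x))) => //.
  by apply: cmeasurableM => //; exact: cintegrable_measurable.
by move=> x; rewrite Normc.normcM ler_wpM2r ?normc_ge0.
Qed.

Lemma cintegrable_bounded f M : (mu setT < +oo)%E -> cmeasurable_fun setT f ->
  (forall x, normc (f x) <= M) -> cintegrable f.
Proof.
move=> muoo mf fM; apply: (@le_cintegrable _ (fun=> M)) => //.
apply: measurable_bounded_integrable => //.
by exists M; split; rewrite ?num_real// => y My x _; rewrite (le_trans _ (ltW My))//
  ger0_norm// (le_trans _ (fM x))// normc_ge0.
Qed.

Lemma cintegrableD f g : cintegrable f -> cintegrable g ->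
  cintegrable (fun x => f x + g x).
Proof.
move=> [f1 f2] [g1 g2]; split; [have := integrableD measurableT f1 g1
                               |have := integrableD measurableT f2 g2].
  by apply: eq_integrable => // x _; rewrite /= ReD EFinD.
by apply: eq_integrable => // x _; rewrite /= ImD EFinD.
Qed.

Lemma cintegrableZ (c : R[i]) f : cintegrable f -> cintegrable (fun x => c * f x).
Proof.
by move=> intf; apply: (@cintegrableMl (fun=> c) f (normc c)) => //; exact: cmeasurable_cst.
Qed.

Lemma cintegralD f g : cintegrable f -> cintegrable g ->
  cintegral mu setT (fun x => f x + g x) =
  cintegral mu setT f + cintegral mu setT g.
Proof.
move=> [f1 f2] [g1 g2]; apply: complexP; rewrite ?ReD ?ImD /=.
  by under eq_Rintegral do rewrite ReD; rewrite RintegralD.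
by under eq_Rintegral do rewrite ImD; rewrite RintegralD.
Qed.

Lemma cintegralZ (c : R[i]) f : cintegrable f ->
  cintegral mu setT (fun x => c * f x) = c * cintegral mu setT f.
Proof.
move=> [f1 f2].
have iZ r h : mu.-integrable setT (EFin \o h) ->
    mu.-integrable setT (EFin \o (fun x => r * h x)).
  by move=> /(integrableZl measurableT r); apply: eq_integrable => // x _; rewrite /= EFinM.
apply: complexP; rewrite ?ReM ?ImM /=.
  under eq_Rintegral do rewrite ReM.
  by rewrite RintegralB ?RintegralZl//; exact: iZ.
under eq_Rintegral do rewrite ImM.
by rewrite RintegralD ?RintegralZl//; exact: iZ.
Qed.

Lemma cintegralN f : cintegrable f ->
  cintegral mu setT (fun x => - f x) = - cintegral mu setT f.
Proof.
move=> intf; rewrite -mulN1r -cintegralZ//; congr cintegral.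
by apply/funext => x; rewrite mulN1r.
Qed.

Lemma cintegrableN f : cintegrable f -> cintegrable (fun x => - f x).
Proof. by move=> /(cintegrableZ (-1)); under eq_fun do rewrite mulN1r. Qed.

Lemma cintegralB f g : cintegrable f -> cintegrable g ->
  cintegral mu setT (fun x => f x - g x) =
  cintegral mu setT f - cintegral mu setT g.
Proof.
by move=> intf intg; rewrite cintegralD ?cintegralN//; exact: cintegrableN.
Qed.

Lemma cintegrable_sum I (r : seq I) (F : I -> T -> R[i]) :
  (forall i, cintegrable (F i)) ->
  cintegrable (fun x => \sum_(i <- r) F i x).
Proof.
move=> iF; elim: r => [|i r ih].
  by under eq_fun do rewrite big_nil; split; exact: integrable0.
by under eq_fun do rewrite big_cons; exact: cintegrableD.
Qed.

Lemma cintegral0 : cintegral mu setT (fun=> 0) = 0.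
Proof. by apply: complexP; rewrite /= /Rintegral integral0. Qed.

Lemma cintegral_sum I (r : seq I) (F : I -> T -> R[i]) :
  (forall i, cintegrable (F i)) ->
  cintegral mu setT (fun x => \sum_(i <- r) F i x) =
  \sum_(i <- r) cintegral mu setT (F i).
Proof.
move=> iF; elim: r => [|i r ih].
  by rewrite big_nil; under eq_fun do rewrite big_nil; rewrite cintegral0.
rewrite big_cons; under eq_fun do rewrite big_cons.
by rewrite cintegralD// ?ih//; exact: cintegrable_sum.
Qed.

(** The factor [2] comes from bounding the two parts separately; a rotation would remove it, but
    only the finiteness of the constants matters later. *)
Lemma normc_cintegral_le f : cintegrable f ->
  normc (cintegral mu setT f) <= 2 * \int[mu]_x normc (f x).
Proof.
move=> intf; have intn := cintegrable_normc intf; case: intf => f1 f2.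
rewrite (le_trans (normc_le_ReIm _))//= mulr_natl mulr2n.
apply: lerD; (apply: le_trans; first exact: le_normr_Rintegral).
  by apply: le_Rintegral => // [|x _]; [exact: integrable_norm|exact: normr_Re_le].
by apply: le_Rintegral => // [|x _]; [exact: integrable_norm|exact: normr_Im_le].
Qed.

Lemma normc_cintegral_le_cst f M : (mu setT < +oo)%E -> cmeasurable_fun setT f ->
  (forall x, normc (f x) <= M) ->
  normc (cintegral mu setT f) <= 2 * (M * fine (mu setT)).
Proof.
move=> muoo mf fM; have intf := cintegrable_bounded muoo mf fM.
rewrite (le_trans (normc_cintegral_le intf))// ler_wpM2l//.
rewrite -Rintegral_cst//; apply: le_Rintegral => //; first exact: cintegrable_normc.
apply: measurable_bounded_integrable => //.
by exists `|M|; split; rewrite ?num_real// => y My x _; exact: ltW.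
Qed.

Lemma ae_eq_cintegral f g : cmeasurable_fun setT f -> cmeasurable_fun setT g ->
  {ae mu, forall x, f x = g x} -> cintegral mu setT f = cintegral mu setT g.
Proof.
move=> [f1 f2] [g1 g2] fg; apply: complexP => /=; congr fine;
  (apply: ae_eq_integral => //; [exact/measurable_EFinP|exact/measurable_EFinP|]);
  by apply: filterS fg => x + _ => ->.
Qed.

(** Convergence by parts is what the real dominated convergence theorem yields; [ccvg_limn] relates
    it to the limits in [R[i]^o] that define the determinant and the minor. *)
Definition ccvg (u : nat -> R[i]) (l : R[i]) :=
  Re (u n) @[n --> \oo] --> Re l /\ Im (u n) @[n --> \oo] --> Im l.

Lemma dominated_cintegral (F : nat -> T -> R[i]) f (g : T -> R) :
  (forall n, cmeasurable_fun setT (F n)) -> cmeasurable_fun setT f ->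
  (forall x, ccvg (F ^~ x) (f x)) -> mu.-integrable setT (EFin \o g) ->
  (forall n x, normc (F n x) <= g x) ->
  ccvg (fun n => cintegral mu setT (F n)) (cintegral mu setT f).
Proof.
move=> mF mf Ff ig Fg.
have key (P : R[i] -> R) : (forall n, measurable_fun setT (fun x => P (F n x))) ->
    measurable_fun setT (fun x => P (f x)) ->
    (forall x, P (F n x) @[n --> \oo] --> P (f x)) ->
    (forall z, `|P z| <= normc z) ->
    \int[mu]_x P (F n x) @[n --> \oo] --> \int[mu]_x P (f x).
  move=> mPF mPf PF Pn.
  have [|||||intf _ cf] := @dominated_convergence _ _ _ mu setT measurableT
    (fun n => EFin \o (fun x => P (F n x))) (EFin \o (fun x => P (f x))) (EFin \o g).
  - by move=> n; exact/measurable_EFinP.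
  - exact/measurable_EFinP.
  - by apply: aeW => x _; apply/fine_cvgP; split; [exact: nearW|exact: PF].
  - exact: ig.
  - by apply: aeW => x n _; rewrite /= lee_fin (le_trans (Pn _)).
  - apply: fine_cvg; rewrite /Rintegral fineK//.
    exact: integrable_fin_num.
split; apply: key.
- by move=> n; exact: (mF n).1.
- exact: mf.1.
- by move=> x; exact: (Ff x).1.
- exact: normr_Re_le.
- by move=> n; exact: (mF n).2.
- exact: mf.2.
- by move=> x; exact: (Ff x).2.
- exact: normr_Im_le.
Qed.

End complex_integrable.

(** * Integrals depending on a parameter and Fubini's theorem *)

Section complex_fubini.
Context d1 d2 (T1 : measurableType d1) (T2 : measurableType d2) (R : realType).
Variable m2 : {sigma_finite_measure set T2 -> \bar R}.

(** Tonelli applies to the positive and the negative part separately and [fine] is measurable, so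
    sections of infinite integral do no harm. *)
Lemma measurable_Rintegral_param (f : T1 * T2 -> R) : measurable_fun setT f ->
  measurable_fun setT (fun x => \int[m2]_y f (x, y)).
Proof.
move=> mf; apply: measurableT_comp => //.
have mef : measurable_fun setT (EFin \o f) by exact/measurable_EFinP.
under eq_fun do rewrite integralE.
apply: emeasurable_funB.
- rewrite (_ : (fun _ => _) = fubini_F m2 ((EFin \o f)^\+)%E); last first.
    by apply/funext => x; apply: eq_integral => y _; rewrite /= !funeposE.
  by apply: measurable_fun_fubini_tonelli_F => //; exact: measurable_funepos.
- rewrite (_ : (fun _ => _) = fubini_F m2 ((EFin \o f)^\-)%E); last first.
    by apply/funext => x; apply: eq_integral => y _; rewrite /= !funenegE.
  by apply: measurable_fun_fubini_tonelli_F => //; exact: measurable_funeneg.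
Qed.

Lemma cmeasurable_cintegral_param (f : T1 * T2 -> R[i]) : cmeasurable_fun setT f ->
  cmeasurable_fun setT (fun x => cintegral m2 setT (fun y => f (x, y))).
Proof.
move=> [f1 f2]; split.
  exact: (measurable_Rintegral_param f1).
exact: (measurable_Rintegral_param f2).
Qed.

Variable m1 : {sigma_finite_measure set T1 -> \bar R}.

Lemma Rintegral_Fubini (f : T1 * T2 -> R) :
  (m1 \x m2)%E.-integrable setT (EFin \o f) ->
  (forall x, m2.-integrable setT (EFin \o (fun y => f (x, y)))) ->
  (forall y, m1.-integrable setT (EFin \o (fun x => f (x, y)))) ->
  \int[m1]_x \int[m2]_y f (x, y) = \int[m2]_y \int[m1]_x f (x, y).
Proof.
move=> intf intf2 intf1; congr fine.
have h2 x : (\int[m2]_y f (x, y))%:E = (\int[m2]_y (f (x, y))%:E)%E.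
  by rewrite /Rintegral fineK//; exact: (integrable_fin_num measurableT (intf2 x)).
have h1 y : (\int[m1]_x f (x, y))%:E = (\int[m1]_x (f (x, y))%:E)%E.
  by rewrite /Rintegral fineK//; exact: (integrable_fin_num measurableT (intf1 y)).
under eq_integral do rewrite h2.
under [RHS]eq_integral do rewrite h1.
exact: (Fubini intf).
Qed.

Lemma cintegral_Fubini (f : T1 * T2 -> R[i]) : cintegrable (m1 \x m2)%E f ->
  (forall x, cintegrable m2 (fun y => f (x, y))) ->
  (forall y, cintegrable m1 (fun x => f (x, y))) ->
  cintegral m1 setT (fun x => cintegral m2 setT (fun y => f (x, y))) =
  cintegral m2 setT (fun y => cintegral m1 setT (fun x => f (x, y))).
Proof.
move=> [f1 f2] h2 h1; apply: complexP => /=.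
  by apply: (@Rintegral_Fubini (fun p => Re (f p))) => // z; [exact: (h2 z).1|exact: (h1 z).1].
by apply: (@Rintegral_Fubini (fun p => Im (f p))) => // z; [exact: (h2 z).2|exact: (h1 z).2].
Qed.

End complex_fubini.

(** * Limits and series of complex numbers *)

Section complex_limits.
Context {R : realType}.
Implicit Types (u v : nat -> R[i]) (l : R[i]).

Lemma ccvg_cst l : ccvg (fun=> l) l.
Proof. by split; exact: cvg_cst. Qed.

Lemma ccvgD u v l l' : ccvg u l -> ccvg v l' ->
  ccvg (fun n => u n + v n) (l + l').
Proof.
move=> [u1 u2] [v1 v2]; split; rewrite ?ReD ?ImD.
  by under eq_fun do rewrite ReD; exact: cvgD.
by under eq_fun do rewrite ImD; exact: cvgD.
Qed.

Lemma ccvgM u v l l' : ccvg u l -> ccvg v l' ->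
  ccvg (fun n => u n * v n) (l * l').
Proof.
move=> [u1 u2] [v1 v2]; split; rewrite ?ReM ?ImM.
  by under eq_fun do rewrite ReM; apply: cvgB; exact: cvgM.
by under eq_fun do rewrite ImM; apply: cvgD; exact: cvgM.
Qed.

Lemma ccvg_unique u l l' : ccvg u l -> ccvg u l' -> l = l'.
Proof.
move=> [u1 u2] [v1 v2]; apply: complexP.
  exact: (cvg_unique _ u1 v1).
exact: (cvg_unique _ u2 v2).
Qed.

Lemma ccvg_shift u l : ccvg u l -> ccvg (fun n => u n.+1) l.
Proof.
move=> [u1 u2]; split.
  by rewrite (cvg_shiftS (fun n => Re (u n))).
by rewrite (cvg_shiftS (fun n => Im (u n))).
Qed.

Lemma ccvg_limn u l : ccvg u l -> limn (u : nat -> R[i]^o) = l.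
Proof.
move=> [u1 u2]; apply: cvg_lim; first exact: norm_hausdorff.
apply/(@cvgrPdist_le _ R[i]^o) => e e0.
(* In the partial order of [R[i]] a positive [e] is real. *)
have eE : e = (Re e)%:C.
  by rewrite RRe_real// realE ltW.
have e2 : 0 < Re e / 2 by rewrite divr_gt0//; move: e0; rewrite ltcE => /andP[].
near=> n.
rewrite normcC eE lecR (le_trans (normc_le_ReIm _))// ReB ImB (splitr (Re e)).
apply: lerD; near: n.
  by move/cvgrPdist_le : u1; apply.
by move/cvgrPdist_le : u2; apply.
Unshelve. all: by end_near.
Qed.

Lemma cmeasurable_ccvg d (T : measurableType d) (F : nat -> T -> R[i])
    (f : T -> R[i]) : (forall n, cmeasurable_fun setT (F n)) ->
  (forall x, ccvg (F ^~ x) (f x)) -> cmeasurable_fun setT f.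
Proof.
move=> mF Ff; split.
  apply: (@measurable_fun_cvg _ _ _ _ (fun n x => Re (F n x))).
    by move=> n; exact: (mF n).1.
  by move=> x _; exact: (Ff x).1.
apply: (@measurable_fun_cvg _ _ _ _ (fun n x => Im (F n x))).
  by move=> n; exact: (mF n).2.
by move=> x _; exact: (Ff x).2.
Qed.

Lemma normc_ccvg_le u l M : ccvg u l -> (forall n, normc (u n) <= M) ->
  normc l <= 2 * M.
Proof.
move=> [u1 u2] uM; rewrite (le_trans (normc_le_ReIm _))// mulr_natl mulr2n.
apply: lerD.
  have u1' : `|Re (u n)| @[n --> \oo] --> `|Re l| by exact: cvg_norm.
  apply: (ler_cvg_to u1' (cvg_cst M)); apply: nearW => n.
  exact: le_trans (normr_Re_le _) (uM n).
have u2' : `|Im (u n)| @[n --> \oo] --> `|Im l| by exact: cvg_norm.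
apply: (ler_cvg_to u2' (cvg_cst M)); apply: nearW => n.
exact: le_trans (normr_Im_le _) (uM n).
Qed.

Lemma ccvg_series (c : nat -> R[i]) M :
  (forall n, normc (c n) <= M / 2 ^+ n) ->
  exists l, ccvg (fun N => \sum_(0 <= n < N) c n) l.
Proof.
move=> cM.
have key (P : R[i] -> R) : (forall z, `|P z| <= normc z) ->
    cvgn (series (fun n => P (c n))).
  move=> Pn; apply: normed_cvg.
  apply: (@series_le_cvg _ _ (geometric M (2^-1))) => [n|n|n|] /=.
  - exact: normr_ge0.
  - rewrite mulr_ge0// ?exprn_ge0//.
    by rewrite (le_trans (normc_ge0 (c 0%N)))// (le_trans (cM _))// expr0 divr1.
  - by rewrite exprVn (le_trans (Pn _)).
  - by apply: is_cvg_geometric_series; rewrite ger0_norm//; lra.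
have sumP (P : R[i] -> R) : (forall x y, P (x + y) = P x + P y) -> P 0 = 0 ->
    (fun N => P (\sum_(0 <= n < N) c n)) = series (fun n => P (c n)).
  by move=> PD P0; apply/funext => N; rewrite /series/= (big_morph P PD P0).
exists (limn (series (fun n => Re (c n))) +i* limn (series (fun n => Im (c n)))).
split => /=; rewrite ?(sumP (@complex.Re R)) ?(sumP (@complex.Im R))//.
- exact: key normr_Re_le.
- exact: ReD.
- exact: key normr_Im_le.
- exact: ImD.
Qed.

End complex_limits.

(** * Hadamard's inequality *)

(* A form of Hadamard's inequality: [|det A|^2] is the product of the eigenvalues of
   [A A^*], whose sum is at most [n^2 M^2]; conclude by AM-GM. *)
Lemma normr_det_sqr_le (C : numClosedFieldType) n (A : 'M[C]_n) (M : C) :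
  (forall i j, `|A i j| <= M) -> `|\det A| ^+ 2 <= (n%:R * M ^+ 2) ^+ n.
Proof.
move=> AM; have [n0|n_gt0] := posnP n.
  by move: A AM; rewrite n0 => A AM; rewrite det_mx00 normr1 expr1n expr0.
pose H := A *m map_mx Num.conj A^T.
have Hherm : map_mx Num.conj H^T = H.
  rewrite /H trmx_mul map_mxM map_trmx trmxK; congr (_ *m _).
  by rewrite -map_mx_comp map_mx_id//; exact: conjCK.
have /orthomx_spectralP HE : H \is normalmx by apply/normalmxP; rewrite Hherm.
set P := spectralmx H in HE; set sp := spectral_diag H in HE.
have Punit : P \in unitmx by exact: spectral_unit.
have detH : \det H = \prod_i sp 0 i.
  by rewrite HE !det_mulmx det_diag mulrAC -det_mulmx mulVmx// det1 mul1r.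
have trH : \tr H = \sum_i sp 0 i.
  by rewrite HE mxtrace_mulC mulmxA mulmxV// mul1mx mxtrace_diag.
have sp_ge0 i : 0 <= sp 0 i.
  (* As [P] is unitary, the diagonal form of [H] is [Q Q^*] for [Q = P A], and its diagonal entries
     are sums of squared moduli. *)
  have DE : diag_mx sp = (P *m A) *m map_mx Num.conj (P *m A)^T.
    rewrite trmx_mul map_mxM mulmxA -(mulmxA P A) -/H.
    rewrite -invmx_unitary ?spectral_unitarymx// -/P HE.
    by rewrite !mulmxA mulmxV// mul1mx -mulmxA mulmxV// mulmx1.
  have /matrixP/(_ i i) := DE; rewrite !mxE eqxx mulr1n => ->.
  by apply: sumr_ge0 => j _; rewrite !mxE mul_conjC_ge0.
have detE : `|\det A| ^+ 2 = \det H.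
  by rewrite normCK /H det_mulmx det_map_mx det_tr.
have trE : \tr H <= n%:R ^+ 2 * M ^+ 2.
  rewrite /mxtrace (le_trans (_ : _ <= \sum_(i < n) \sum_(j < n) M ^+ 2))//.
    apply: ler_sum => i _; rewrite !mxE; apply: ler_sum => j _; rewrite !mxE.
    by rewrite -normCK; apply: lerXn2r; rewrite ?nnegrE// (le_trans _ (AM i j)).
  by rewrite !sumr_const !card_ord -[leLHS]mulr_natl -[X in _ * X]mulr_natl mulrA -expr2.
have nz : (n%:R : C) != 0 by rewrite pnatr_eq0 -lt0n.
rewrite detE detH.
have [+ _] := @leif_AGM C 'I_n predT (sp 0) (fun i _ => sp_ge0 i).
rewrite -trH cardT size_enum_ord => h; apply: (le_trans h).
apply: lerXn2r; rewrite ?nnegrE.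
- by rewrite divr_ge0// trH sumr_ge0.
- rewrite mulr_ge0// exprn_ge0//; exact: le_trans (AM (Ordinal n_gt0) (Ordinal n_gt0)).
- by rewrite ler_pdivrMr ?ltr0n// (le_trans trE)// expr2 mulrAC.
Qed.

(** * Geometric decay of the Fredholm coefficients *)

Section series_bounds.
Context {R : realType}.

Lemma normc_det_sqr_le n (A : 'M[R[i]]_n) (M : R) :
  (forall i j, normc (A i j) <= M) ->
  normc (\det A) ^+ 2 <= (n%:R * M ^+ 2) ^+ n.
Proof.
move=> AM; have := @normr_det_sqr_le _ n A M%:C.
have -> : (n%:R * M%:C ^+ 2) ^+ n = (((n%:R * M ^+ 2) ^+ n)%:C : R[i]).
  by rewrite rmorphXn rmorphM rmorph_nat rmorphXn.
rewrite normcC -rmorphXn lecR; apply => i j.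
by rewrite normcC lecR.
Qed.

Lemma expR_ge1 (x : R) : 0 <= x -> 1 <= expR x.
Proof. by move=> x0; rewrite -expR0 ler_expR. Qed.

Lemma exprn_fact_le_expR (x : R) n : 0 <= x -> x ^+ n / n`!%:R <= expR x.
Proof.
case: n => [|n] x0; first by rewrite fact0 divr1 expr0 expR_ge1.
have := expR_ge1Dxn n x0; apply: le_trans; by rewrite lerDr.
Qed.

(** In the square of d / n!, one factorial compensates (n+1)^(n+1) up to an exponential factor and
    the other beats every power; hence the ratio 1/2 is reached for every [c], and the series
    converge for every [kappa]. Working with squares keeps square roots out of the estimate. *)
Lemma geometric_bound (c : R) : exists C : R, forall n d, 0 <= d ->
  d ^+ 2 <= n.+1%:R ^+ n.+1 * (c ^+ 2) ^+ n -> d / n`!%:R <= C / 2 ^+ n.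
Proof.
(* The [8] is [4] times [2]: the square of the target 2^n is 4^n, and n+1 is at most 2^n. The powers
   of [e] come from n^n <= e^n n!, and the exponential bounds x^n / n!. As [B] is at least [1], a
   bound by [B] is also one by its square. *)
pose e : R := expR 1; pose B := e * expR (8 * e * c ^+ 2).
have e1 : 1 <= e by rewrite /e expR_ge1.
have B1 : 1 <= B.
  by rewrite mulr_ege1// expR_ge1// mulr_ge0 ?sqr_ge0// mulr_ge0// (le_trans ler01).
exists B => n d d0 dle.
have nf m : 0 < m`!%:R :> R by rewrite ltr0n fact_gt0.
rewrite -(@ler_pXn2r _ 2)// ?nnegrE; last 2 first.
- by rewrite divr_ge0// ltW.
- by rewrite divr_ge0 ?exprn_ge0// (le_trans ler01).
(* [n^n <= e^n n!] turns the Hadamard bound into a bound by [x^n / n!]. *)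
have h1 : n.+1%:R ^+ n.+1 <= e ^+ n.+1 * (n.+1%:R * n`!%:R).
  have := @exprn_fact_le_expR n.+1%:R n.+1 (ler0n _ _).
  by rewrite ler_pdivrMr// factS natrM /e -expRM_natl mulr1.
have h2 : (n.+1%:R : R) <= 2 ^+ n by rewrite -natrX ler_nat ltn_expl.
have h3 : (8 * e * c ^+ 2) ^+ n / n`!%:R <= expR (8 * e * c ^+ 2).
  apply: exprn_fact_le_expR.
  by rewrite mulr_ge0 ?sqr_ge0// mulr_ge0// (le_trans ler01).
have e0 : 0 <= e by rewrite (le_trans ler01).
have -> : (d / n`!%:R) ^+ 2 = d ^+ 2 / n`!%:R / n`!%:R.
  by field; rewrite gt_eqF.
have -> : (B / 2 ^+ n) ^+ 2 = B ^+ 2 / 4 ^+ n.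
  rewrite expr_div_n; congr (_ / _).
  by rewrite -exprM mulnC exprM; congr (_ ^+ _); rewrite expr2; ring.
apply: (@le_trans _ _ (B / 4 ^+ n)); last first.
  by rewrite ler_pM2r ?invr_gt0 ?exprn_gt0// expr2 ler_peMl// (le_trans ler01).
apply: (@le_trans _ _ (e * ((8 * e * c ^+ 2) ^+ n / n`!%:R) / 4 ^+ n)); last first.
  by rewrite ler_pM2r ?invr_gt0 ?exprn_gt0// ler_wpM2l.
rewrite mulrA.
rewrite ler_pdivrMr//.
apply: (@le_trans _ _ (e ^+ n.+1 * (2 ^+ n * n`!%:R) * (c ^+ 2) ^+ n / n`!%:R)).
  rewrite ler_pM2r ?invr_gt0// (le_trans dle)// ler_wpM2r//.
    by rewrite exprn_ge0// sqr_ge0.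
  rewrite (le_trans h1)// ler_wpM2l ?exprn_ge0// ler_wpM2r// ltW//.
have -> : (8 * e * c ^+ 2) ^+ n = 4 ^+ n * 2 ^+ n * e ^+ n * (c ^+ 2) ^+ n.
  by rewrite -!exprMn; congr (_ ^+ _); ring.
by rewrite le_eqVlt; apply/orP; left; apply/eqP; rewrite exprS; field;
  rewrite !expf_neq0 ?gt_eqF.
Qed.

End series_bounds.

(** * Measures on tuples *)

Section restricted_measure.
Context d (T : measurableType d) (R : realType).
Variables (mu nu : {measure set T -> \bar R}) (D : set T).
Hypothesis mD : measurable D.
Hypothesis nuE : forall A, measurable A -> nu A = mu (A `&` D).

(** This trades an integral over [D] for one over the whole space, where no domain has to be carried
    along. It serves for the cube, its square and its powers of tuples alike. *)
Lemma integral_restricted (f : T -> \bar R) : measurable_fun setT f ->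
  (\int[nu]_x f x = \int[mu]_(x in D) f x)%E.
Proof.
move=> mf; transitivity (\int[nu]_(x in D) f x)%E.
  rewrite [RHS]integral_mkcond; apply: ae_eq_integral => //.
    by apply/(measurable_restrictT _ mD); exact: measurable_funTS.
  exists (~` D); split.
  - exact: measurableC.
  - by rewrite nuE ?setICl ?measure0//; exact: measurableC.
  - by move=> x /=; apply: contra_not => Dx _; rewrite patchE mem_set.
by apply: eq_measure_integral => A mA AD; rewrite nuE// setIidl.
Qed.

Lemma Rintegral_restricted (f : T -> R) : measurable_fun setT f ->
  \int[nu]_x f x = \int[mu]_(x in D) f x.
Proof. by move=> mf; congr fine; apply: integral_restricted; exact/measurable_EFinP. Qed.

Lemma cintegral_restricted (f : T -> R[i]) : cmeasurable_fun setT f ->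
  cintegral nu setT f = cintegral mu D f.
Proof. by move=> [f1 f2]; apply: complexP => /=; exact: Rintegral_restricted. Qed.

Lemma ae_restricted (P : T -> Prop) :
  {ae nu, forall x, P x} <-> {ae mu, forall x, D x -> P x}.
Proof.
split=> [[N [mN N0 PN]]|[N [mN N0 PN]]].
  exists (N `&` D); split; first exact: measurableI.
    by rewrite -nuE.
  by move=> x /not_implyP[Dx nPx]; split=> //; exact: PN.
exists (N `|` ~` D); split.
- by apply: measurableU => //; exact: measurableC.
- rewrite nuE; last by apply: measurableU => //; exact: measurableC.
  rewrite setIUl setICl setU0; apply/eqP; rewrite -measure_le0 -N0.
  by apply: le_measure; rewrite ?inE//; exact: measurableI.
- move=> x nPx; have [Dx|] := pselect (D x); last by right.
  by left; apply: PN => /(_ Dx).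
Qed.

End restricted_measure.

Section image_product_measure.
Context d0 d1 d2 (S : measurableType d0) (T1 : measurableType d1)
  (T2 : measurableType d2) (R : realType).
Variables (mu : {measure set S -> \bar R}).
Variables (m1 : {sigma_finite_measure set T1 -> \bar R})
  (m2 : {sigma_finite_measure set T2 -> \bar R}).
Variable e : S -> T1 * T2.
Hypothesis me : measurable_fun setT e.
Hypothesis eE : forall X, measurable X -> (m1 \x m2)%E X = mu (e @^-1` X).

Lemma integral_image_product (f : T1 * T2 -> \bar R) : measurable_fun setT f ->
  mu.-integrable setT (f \o e) ->
  (m1 \x m2)%E.-integrable setT f /\
  (\int[mu]_t f (e t) = \int[m1 \x m2]_p f p)%E.
Proof.
move=> mf intf.
have intp := integrable_pushforward me mf intf measurableT.
have intE := integral_pushforward me mf intf measurableT.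
split; last first.
  by rewrite -[LHS]intE; apply: eq_measure_integral => X mX _; rewrite [RHS]eE.
move/integrableP : intp => [_ intp]; apply/integrableP; split; first exact: mf.
apply: le_lt_trans intp; rewrite le_eqVlt; apply/orP; left; apply/eqP.
by apply: eq_measure_integral => X mX _; exact: eE.
Qed.

Lemma Rintegral_image_product (f : T1 * T2 -> R) : measurable_fun setT f ->
  mu.-integrable setT (EFin \o (fun t => f (e t))) ->
  (forall x, m2.-integrable setT (EFin \o (fun u => f (x, u)))) ->
  \int[mu]_t f (e t) = \int[m1]_x \int[m2]_u f (x, u).
Proof.
move=> mf intf intf2.
have mef : measurable_fun setT (EFin \o f) by exact/measurable_EFinP.
have [intp intE] := integral_image_product mef intf.
have h2 x : (\int[m2]_u f (x, u))%:E = (\int[m2]_u (f (x, u))%:E)%E.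
  by rewrite /Rintegral fineK//; exact: (integrable_fin_num measurableT (intf2 x)).
congr fine; under [RHS]eq_integral do rewrite h2.
by rewrite [LHS]intE -(integral12_prod_meas1 intp).
Qed.

Lemma cintegral_image_product (f : T1 * T2 -> R[i]) : cmeasurable_fun setT f ->
  cintegrable mu (fun t => f (e t)) ->
  (forall x, cintegrable m2 (fun u => f (x, u))) ->
  cintegral mu setT (fun t => f (e t)) =
  cintegral m1 setT (fun x => cintegral m2 setT (fun u => f (x, u))).
Proof.
move=> [f1 f2] [i1 i2] h; apply: complexP => /=.
  by apply: (@Rintegral_image_product (fun p => Re (f p))) => // x; exact: (h x).1.
by apply: (@Rintegral_image_product (fun p => Im (f p))) => // x; exact: (h x).2.
Qed.

End image_product_measure.

Section tuple_measure_theory.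
Context d (T : measurableType d) (R : realType).

Section sigma_finite_tuple_measure.
Variable mu : {sigma_finite_measure set T -> \bar R}.
Local Notation tau := (tuple_measure mu).

Definition tcons n (p : T * n.-tuple T) : n.+1.-tuple T := [tuple of p.1 :: p.2].

Lemma measurable_tcons n : measurable_fun setT (@tcons n).
Proof. exact: measurable_cons. Qed.

Lemma tuple_measureS n (S : set (n.+1.-tuple T)) :
  tau n.+1 S = (mu \x tau n)%E (@tcons n @^-1` S).
Proof. by []. Qed.

Definition extract_tnth n (j : 'I_n.+1) (t : n.+1.-tuple T) : T * n.-tuple T :=
  (tnth t j, [tuple tnth t (lift j i) | i < n]).

Lemma measurable_extract_tnth n (j : 'I_n.+1) :
  measurable_fun setT (@extract_tnth n j).
Proof.
apply/measurable_fun_pair; first exact: measurable_tnth.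
apply/measurable_fun_tnthP => i.
rewrite (_ : _ \o _ = (@tnth n.+1 T)^~ (lift j i)); first exact: measurable_tnth.
by apply/funext => t /=; rewrite tnth_mktuple.
Qed.

Lemma extract_tnth0 n (p : T * n.-tuple T) : extract_tnth ord0 (tcons p) = p.
Proof.
case: p => x u; congr pair; apply: eq_from_tnth => i; rewrite tnth_mktuple.
by rewrite tnthS.
Qed.

Lemma extract_tnthS n (j : 'I_n.+1) (x : T) (u : n.+1.-tuple T) :
  extract_tnth (lift ord0 j) (tcons (x, u)) =
  ((extract_tnth j u).1, tcons (x, (extract_tnth j u).2)).
Proof.
congr pair; first by rewrite tnthS.
apply: eq_from_tnth => i; rewrite tnth_mktuple.
case: (unliftP ord0 i) => [i' ->|->].
  rewrite /tcons /= tnthS tnth_mktuple.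
  rewrite (_ : lift _ _ = lift ord0 (lift j i')) ?tnthS//.
  by apply: val_inj; rewrite /= /bump /= !add1n ltnS addnS.
rewrite (_ : lift _ _ = ord0)//.
exact: val_inj.
Qed.

Lemma extract_tnth0_tuple_measure n (X : set (T * n.-tuple T)) :
  tau n.+1 (extract_tnth ord0 @^-1` X) = (mu \x tau n)%E X.
Proof.
rewrite tuple_measureS; set Y := (X in (mu \x tau n)%E X = _).
suff -> : Y = X by [].
by apply/seteqP; split=> p; rewrite /Y -comp_preimage /preimage /= extract_tnth0.
Qed.

(* Slicing along the first coordinate commutes with extracting a later one. *)
Lemma extract_tnth_tuple_measure_rect n (j : 'I_n.+1) (A : set T)
    (B : set (n.-tuple T)) : measurable A -> measurable B ->
  tau n.+1 (extract_tnth j @^-1` (A `*` B)) = (mu A * tau n B)%E.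
Proof.
elim: n j B => [|n IH] j B mA mB.
  have -> : j = ord0 by exact: ord1.
  by rewrite extract_tnth0_tuple_measure; exact: product_measure1E.
have [->|j0] := eqVneq j ord0.
  by rewrite extract_tnth0_tuple_measure; exact: product_measure1E.
have [j' ->] : exists j', j = lift ord0 j'.
  by case: (unliftP ord0 j) j0 => [j' ->|->]; [exists j'|rewrite eqxx].
rewrite tuple_measureS /product_measure1.
set S := @tcons n.+1 @^-1` _.
have mC : measurable (@tcons n @^-1` B).
  by rewrite -[X in measurable X]setTI; exact: measurable_tcons.
have SE x : xsection S x = extract_tnth j' @^-1`
    (A `*` xsection (@tcons n @^-1` B) x).
  apply/funext => u; apply/propext.
  apply: (@iff_trans _ ((A `*` B) (extract_tnth (lift ord0 j') (tcons (x, u))))).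
    by rewrite /xsection /= inE.
  by rewrite extract_tnthS; split=> -[Au Bu]; split=> //; move: Bu;
    rewrite /xsection /= inE.
have SI x : tau n.+1 (xsection S x) = (mu A * (tau n \o xsection (@tcons n @^-1` B)) x)%E.
  by rewrite SE IH//; exact: measurable_xsection.
transitivity (\int[mu]_x (mu A * (tau n \o xsection (@tcons n @^-1` B)) x))%E.
  by apply: eq_integral => x _; exact: SI.
by rewrite ge0_integralZl//; exact: measurable_fun_xsection.
Qed.

(** The symmetry of the tuple measure in the form that the row expansion needs: any coordinate may
    act as the first. A product of sigma-finite measures is determined by its values on
    rectangles. *)
Lemma extract_tnth_tuple_measure n (j : 'I_n.+1) (X : set (T * n.-tuple T)) :
  measurable X ->
  (mu \x tau n)%E X = tau n.+1 (extract_tnth j @^-1` X).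
Proof.
move=> mX.
pose nu := measure_function_pushforward__canonical__measure_function_Measure
  (tau n.+1) (@measurable_extract_tnth n j).
apply: (product_measure_unique (m' := nu)) => // A B mA mB.
exact: extract_tnth_tuple_measure_rect.
Qed.

Lemma cintegral_extract_tnth n (j : 'I_n.+1) (f : T * n.-tuple T -> R[i]) :
  cmeasurable_fun setT f ->
  cintegrable (tau n.+1) (fun t => f (extract_tnth j t)) ->
  (forall x, cintegrable (tau n) (fun u => f (x, u))) ->
  cintegral (tau n.+1) setT (fun t => f (extract_tnth j t)) =
  cintegral mu setT (fun x => cintegral (tau n) setT (fun u => f (x, u))).
Proof.
exact: (cintegral_image_product (@measurable_extract_tnth n j)
  (@extract_tnth_tuple_measure n j)).
Qed.

Lemma cintegral_tuple0 (f : 0.-tuple T -> R[i]) : cmeasurable_fun setT f ->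
  cintegral (tau 0) setT f = f [tuple].
Proof.
move=> [f1 f2]; apply: complexP => /=.
  by rewrite /Rintegral integral_dirac ?diracT ?mul1e//; exact/measurable_EFinP.
by rewrite /Rintegral integral_dirac ?diracT ?mul1e//; exact/measurable_EFinP.
Qed.

Lemma measurable_tuple_set (D : set T) n : measurable D ->
  measurable (@tuple_set _ T D n).
Proof.
move=> mD; rewrite (_ : @tuple_set _ T D n = \big[setI/setT]_(i < n)
    ((@tnth n T)^~ i @^-1` D)).
  apply: bigsetI_measurable => i _.
  by rewrite -[X in measurable X]setTI; exact: measurable_tnth.
apply/seteqP; split=> t.
  by move=> Dt; elim/big_ind : _ => // i _; exact: Dt.
by move=> + i; rewrite (bigD1 i)//= => -[].
Qed.

End sigma_finite_tuple_measure.

Lemma tuple_measure_setT (m : {finite_measure set T -> \bar R}) n :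
  tuple_measure m n setT = (fine (m setT) ^+ n)%:E.
Proof.
elim: n => [|n IH]; first by rewrite /= diracT expr0.
transitivity (m setT * tuple_measure m n setT)%E.
  by rewrite -product_measure1E// setXTT.
by rewrite IH exprS EFinM fineK// fin_num_measure.
Qed.

(** Restriction commutes with one product, by comparison on rectangles, hence with powers by
    induction. *)
Lemma tuple_measure_restricted (mu : {sigma_finite_measure set T -> \bar R})
    (m : {finite_measure set T -> \bar R}) (D : set T) : measurable D ->
  (forall A, measurable A -> m A = mu (A `&` D)) ->
  forall n A, measurable A ->
  tuple_measure m n A = tuple_measure mu n (A `&` @tuple_set _ T D n).
Proof.
move=> mD mE; elim=> [|n IH] A mA.
  rewrite (_ : @tuple_set _ T D 0 = setT) ?setIT//.
  by apply/seteqP; split=> t // _ [].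
rewrite !tuple_measureS preimage_setI.
have -> : @tcons n @^-1` @tuple_set _ T D n.+1 = D `*` @tuple_set _ T D n.
  apply/seteqP; split=> -[x u]; rewrite /preimage /tuple_set /=.
    move=> h; split=> [|i]; first by have := h ord0; rewrite tnth0.
    by have := h (lift ord0 i); rewrite tnthS.
  move=> [Dx Du] i; case: (unliftP ord0 i) => [i' ->|->]; first by rewrite tnthS.
  by rewrite tnth0.
have mDn : measurable (D `*` @tuple_set _ T D n).
  by apply: measurableX => //; exact: measurable_tuple_set.
pose nu : {measure set (T * n.-tuple T) -> \bar R} := mrestr
  (mu \x tuple_measure mu n)%E mDn.
apply: (product_measure_unique (m' := nu)) => [A' B' mA' mB'|].
  rewrite /nu /= /mrestr -setXI product_measure1E; last 2 first.
  - exact: measurableI.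
  - by apply: measurableI => //; exact: measurable_tuple_set.
  by rewrite mE// IH.
by rewrite -[X in measurable X]setTI; exact: measurable_tcons.
Qed.

End tuple_measure_theory.

(** * The Fredholm series *)

Section bordered_determinant.
Context d (T : measurableType d) (R : comNzRingType) (f : T -> T -> R).

Definition kernel_mx q (u v : q.-tuple T) : 'M[R]_q :=
  \matrix_(i < q, j < q) f (tnth u i) (tnth v j).

(** The sign of the cofactor and the sign of reordering the rows multiply to [-1] whatever [j] is.
    After integration the terms can therefore be equal, and not alternating. *)
Lemma det_kernel_mx_tcons n (x s : T) (t : n.+1.-tuple T) :
  \det (kernel_mx (tcons (x, t)) (tcons (s, t))) =
  f x s * \det (kernel_mx t t) -
  \sum_(j < n.+1) f x (tnth t j) *
    \det (kernel_mx (tcons (extract_tnth j t)) (tcons (s, (extract_tnth j t).2))).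
Proof.
rewrite (expand_det_row _ ord0) big_ord_recl -sumrN; congr (_ + _).
  rewrite mxE !tnth0 /cofactor addn0 expr0 mul1r; congr (_ * \det _).
  by apply/matrixP => i j; rewrite !mxE !tnthS.
apply: eq_bigr => j _; rewrite mxE tnth0 tnthS -mulrN; congr (_ * _).
pose N := kernel_mx (tcons (extract_tnth j t)) (tcons (s, (extract_tnth j t).2)).
rewrite /cofactor -/N; set A := row' _ _.
(* Moving the row of [tnth t j] to the top costs the sign [(-1) ^+ j]. *)
have NE : N = row_perm (lift_perm ord0 j 1) (A : 'M[R]_n.+1).
  apply/matrixP => r c; rewrite !mxE.
  have -> : tnth (tcons (x, t)) (lift ord0 (lift_perm ord0 j 1 r)) =
      tnth (tcons (extract_tnth j t)) r.
    rewrite tnthS; case: (unliftP ord0 r) => [r' ->|->].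
      by rewrite lift_perm_lift perm1 /tcons tnthS /= tnth_mktuple.
    by rewrite lift_perm_id /tcons tnth0.
  congr (f _ _); case: (unliftP ord0 c) => [c' ->|->].
    rewrite [LHS]tnthS tnth_mktuple.
    rewrite (_ : lift (lift ord0 j) (lift ord0 c') = lift ord0 (lift j c')) ?tnthS//.
    by apply: val_inj; rewrite /= /bump /= !add1n ltnS addnS.
  rewrite (_ : lift (lift ord0 j) ord0 = ord0) ?tnth0//.
  exact: val_inj.
rewrite NE row_permE det_mulmx det_perm odd_lift_perm odd_perm1 addbF /= add0n.
rewrite /bump /= add1n exprS mulN1r mulNr; congr (- _).
by rewrite signr_odd.
Qed.

End bordered_determinant.

Section fredholm_series.
Context d (T : measurableType d) dY (Y : measurableType dY) (R : realType).
Variable m : {finite_measure set T -> \bar R}.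
Variables (kappa : R[i]) (M C : R).
Hypothesis M0 : 0 <= M.
(* [C] comes from [geometric_bound]; it depends on [k] only through [M], which makes
   the bounds below uniform in [y]. *)
Hypothesis hC : forall n d, 0 <= d ->
  d ^+ 2 <= n.+1%:R ^+ n.+1 * ((normc kappa * M * fine (m setT)) ^+ 2) ^+ n ->
  d / n`!%:R <= C / 2 ^+ n.
Variable k : T -> T -> Y -> R[i].
Hypothesis mk : cmeasurable_fun setT (fun p : T * T * Y => k p.1.1 p.1.2 p.2).
Hypothesis kM : forall x s y, normc (k x s y) <= M.

Local Notation tau n := (tuple_measure m n).
Local Notation ky y := (fun x s => k x s y).

Definition det_coef n y : R[i] :=
  cintegral (tau n) setT (fun t => \det (kernel_mx (ky y) t t)).
Definition minor_coef n x s y : R[i] := cintegral (tau n) setT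
  (fun t => \det (kernel_mx (ky y) (tcons (x, t)) (tcons (s, t)))).

Let c n : R[i] := (- kappa) ^+ n / n`!%:R.

Lemma tuple_measure_lty n : (tau n setT < +oo)%E.
Proof. by rewrite tuple_measure_setT ltry. Qed.

Lemma cmeasurable_det_kernel_mx dP (P : measurableType dP) q
    (u v : P -> q.-tuple T) (w : P -> Y) : measurable_fun setT u ->
  measurable_fun setT v -> measurable_fun setT w ->
  cmeasurable_fun setT (fun p => \det (kernel_mx (ky (w p)) (u p) (v p))).
Proof.
move=> mu mv mw; apply: cmeasurable_det => i j.
under eq_fun do rewrite mxE.
apply: (cmeasurable_comp (g := fun p => (tnth (u p) i, tnth (v p) j, w p)) mk).
apply/measurable_fun_pair => //; apply/measurable_fun_pair.
  exact: (measurableT_comp (measurable_tnth i) mu).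
exact: (measurableT_comp (measurable_tnth j) mv).
Qed.

Lemma cmeasurable_det_coef n : cmeasurable_fun setT (det_coef n).
Proof.
apply: (cmeasurable_cintegral_param (tau n)
  (f := fun p : Y * n.-tuple T => \det (kernel_mx (ky p.1) p.2 p.2))).
exact: cmeasurable_det_kernel_mx.
Qed.

Lemma cmeasurable_minor_coef n :
  cmeasurable_fun setT (fun p : T * T * Y => minor_coef n p.1.1 p.1.2 p.2).
Proof.
apply: (cmeasurable_cintegral_param (tau n)
  (f := fun p : (T * T * Y) * n.-tuple T =>
    \det (kernel_mx (ky p.1.2) (tcons (p.1.1.1, p.2)) (tcons (p.1.1.2, p.2))))).
apply: cmeasurable_det_kernel_mx => //; last by apply: measurableT_comp.
  apply: (measurableT_comp (@measurable_tcons _ T n)).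
  apply/measurable_fun_pair => //; apply: measurableT_comp => //.
  exact: measurableT_comp.
apply: (measurableT_comp (@measurable_tcons _ T n)).
apply/measurable_fun_pair => //; apply: measurableT_comp => //.
exact: measurableT_comp.
Qed.

Lemma normc_det_kernel_mx_le q (u v : q.-tuple T) y :
  normc (\det (kernel_mx (ky y) u v)) <= Num.sqrt (q%:R ^+ q) * M ^+ q.
Proof.
rewrite -(@ler_pXn2r _ 2)// ?nnegrE ?normc_ge0//; last first.
  by rewrite mulr_ge0 ?exprn_ge0.
rewrite exprMn sqr_sqrtr ?exprn_ge0// -exprM mulnC exprM -exprMn.
by apply: normc_det_sqr_le => i j; rewrite mxE.
Qed.

Lemma normc_coef n : normc (c n) = normc kappa ^+ n / n`!%:R.
Proof.
have Cinj (z : R[i]) (r : R) : `|z| = r%:C -> normc z = r.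
  by rewrite normcC => /complexI.
apply: Cinj; rewrite /c normrM normrX normrN normcC normfV.
by rewrite normr_nat rmorphM rmorphXn fmorphV rmorph_nat.
Qed.

(** The assumed bound is Hadamard's for order [n.+1] with one factor [M] replaced by [B]. Taking [B]
    to be [1] covers the determinant and [B] to be [M] covers the minor. *)
Lemma normc_coefM_le n (F : n.-tuple T -> R[i]) B : 0 <= B ->
  cmeasurable_fun setT F ->
  (forall t, normc (F t) <= Num.sqrt (n.+1%:R ^+ n.+1) * M ^+ n * B) ->
  normc (c n * cintegral (tau n) setT F) <= (2 * B * C) / 2 ^+ n.
Proof.
move=> B0 mF FB; rewrite Normc.normcM normc_coef.
have mE : fine (tau n setT) = fine (m setT) ^+ n by rewrite tuple_measure_setT.
have := normc_cintegral_le_cst (tuple_measure_lty n) mF FB.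
rewrite [fine _]mE => h.
set mu := fine (m setT) in h *.
have mu0 : 0 <= mu by rewrite fine_ge0.
pose dd := normc kappa ^+ n * (Num.sqrt (n.+1%:R ^+ n.+1) * M ^+ n * mu ^+ n).
have dd0 : 0 <= dd by rewrite !mulr_ge0 ?exprn_ge0 ?normc_ge0 ?sqrtr_ge0.
have ddC : dd / n`!%:R <= C / 2 ^+ n.
  apply: hC => //; rewrite /dd -/mu !exprMn sqr_sqrtr ?exprn_ge0//.
  by rewrite le_eqVlt; apply/orP; left; apply/eqP; ring.
apply: (@le_trans _ _ (2 * B * (dd / n`!%:R))).
  rewrite mulrAC [leRHS]mulrA ler_wpM2r ?invr_ge0//.
  apply: (le_trans (ler_wpM2l (exprn_ge0 _ (normc_ge0 _)) h)).
  by rewrite le_eqVlt; apply/orP; left; apply/eqP; rewrite /dd; ring.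
by rewrite -[leRHS]mulrA ler_wpM2l// mulr_ge0.
Qed.

Lemma normc_det_coef_le n y : normc (c n * det_coef n y) <= (2 * 1 * C) / 2 ^+ n.
Proof.
apply: normc_coefM_le => // [|t].
  exact: cmeasurable_det_kernel_mx.
apply: (le_trans (normc_det_kernel_mx_le _ _ _)); rewrite mulr1.
rewrite ler_wpM2r ?exprn_ge0// ler_wsqrtr// -!natrX ler_nat.
apply: (@leq_trans (n.+1 ^ n)); last exact: leq_pexp2l.
by case: (n) => // n'; rewrite leq_exp2r.
Qed.

Lemma normc_minor_coef_le n x s y :
  normc (c n * minor_coef n x s y) <= (2 * M * C) / 2 ^+ n.
Proof.
apply: normc_coefM_le => // [|t].
  apply: cmeasurable_det_kernel_mx => //;
  by apply: (measurableT_comp (@measurable_tcons _ T n)); exact: measurable_fun_pair.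
by apply: (le_trans (normc_det_kernel_mx_le _ _ _)); rewrite -mulrA -exprSr.
Qed.

Lemma sum_geometric_le B N : 0 <= B -> \sum_(0 <= n < N) B / 2 ^+ n <= 2 * B :> R.
Proof.
move=> B0; have -> : \sum_(0 <= n < N) B / 2 ^+ n = 2 * B - 2 * B / 2 ^+ N.
  elim: N => [|N IH]; first by rewrite big_geq// expr0 divr1 subrr.
  by rewrite big_nat_recr//= IH exprS; field; rewrite expf_neq0.
by rewrite gerBl// divr_ge0 ?mulr_ge0 ?exprn_ge0.
Qed.

Lemma coef_bound_ge0 : 0 <= C.
Proof.
have := @hC 0%N 0 (lexx _); rewrite mul0r expr0 divr1; apply.
by rewrite expr2 mul0r expr1 mulr1.
Qed.

Lemma det_coef0 y : det_coef 0 y = 1.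
Proof.
rewrite /det_coef cintegral_tuple0 ?det_mx00//.
exact: cmeasurable_det_kernel_mx.
Qed.

Lemma minor_coef0 x s y : minor_coef 0 x s y = k x s y.
Proof.
rewrite /minor_coef cintegral_tuple0; last first.
  apply: cmeasurable_det_kernel_mx => //;
  by apply: (measurableT_comp (@measurable_tcons _ T 0)); exact: measurable_fun_pair.
by rewrite det_mx11 mxE !tnth0.
Qed.

Lemma tuple_set_setT n : @tuple_set _ T setT n = setT.
Proof. exact/seteqP. Qed.

(** The definitions set the term of index [0] apart. Putting it back, with [c 0 = 1], allows
    determinant and minor to be treated as series from [0]. *)
Lemma fredholm_sum_shift (a : nat -> R[i]) l :
  ccvg (fun N => \sum_(0 <= n < N) c n * a n) l ->
  a 0%N + limn (fun N => \sum_(1 <= n < N) c n * a n : R[i]^o) = l.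
Proof.
move=> /ccvg_shift al.
have := ccvgD al (ccvg_cst (- a 0%N)).
have -> : (fun n => \sum_(0 <= i < n.+1) c i * a i - a 0%N) =
    (fun N => \sum_(1 <= n < N.+1) c n * a n).
  apply/funext => N; rewrite big_nat_recl// big_add1 /= /c expr0 fact0 divr1 mul1r.
  by rewrite addrC addKr.
move=> h; have {}h : ccvg (fun N => \sum_(1 <= n < N) c n * a n) (l - a 0%N).
  by case: h => h1 h2; split; rewrite -cvg_shiftS.
by rewrite (ccvg_limn h) addrC subrK.
Qed.

Lemma ccvg_fredholm_det y : ccvg (fun N => \sum_(0 <= n < N) c n * det_coef n y)
  (fredholm_det m setT (ky y) kappa).
Proof.
have [l hl] := ccvg_series (fun n => normc_det_coef_le n y).
suff -> : fredholm_det m setT (ky y) kappa = l by [].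
rewrite -[RHS](fredholm_sum_shift hl) det_coef0 /fredholm_det; congr (_ + _).
apply: (congr1 (fun u : nat -> R[i]^o => limn u)); apply/funext => N; apply: eq_bigr => n _.
by rewrite /det_coef tuple_set_setT.
Qed.

Lemma ccvg_fredholm_minor x s y :
  ccvg (fun N => \sum_(0 <= n < N) c n * minor_coef n x s y)
  (fredholm_minor m setT (ky y) x s kappa).
Proof.
have [l hl] := ccvg_series (fun n => normc_minor_coef_le n x s y).
suff -> : fredholm_minor m setT (ky y) x s kappa = l by [].
rewrite -[RHS](fredholm_sum_shift hl) minor_coef0 /fredholm_minor; congr (_ + _).
apply: (congr1 (fun u : nat -> R[i]^o => limn u)); apply/funext => N; apply: eq_bigr => n _.
by rewrite /minor_coef tuple_set_setT.
Qed.

(** Uniform in [N] as well as in the points: this is the majorant for passing to the limit under the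
    integral. *)
Lemma normc_minor_sum_le N x s y :
  normc (\sum_(0 <= n < N) c n * minor_coef n x s y) <= 2 * (2 * M * C).
Proof.
rewrite (le_trans (normc_le_sum _ _ _))// (le_trans _ (sum_geometric_le N _))//.
  by apply: ler_sum => n _; exact: normc_minor_coef_le.
by rewrite !mulr_ge0// coef_bound_ge0.
Qed.

(** From the inside out, the factors [2] come from the integral of a complex function, from the
    geometric series and from the limit by parts. *)
Lemma normc_fredholm_minor_le x s y :
  normc (fredholm_minor m setT (ky y) x s kappa) <= 2 * (2 * (2 * M * C)).
Proof.
apply: (normc_ccvg_le (ccvg_fredholm_minor x s y)) => N.
exact: normc_minor_sum_le.
Qed.

Lemma cmeasurable_fredholm_det :
  cmeasurable_fun setT (fun y => fredholm_det m setT (ky y) kappa).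
Proof.
apply: (cmeasurable_ccvg _ ccvg_fredholm_det) => N.
apply: cmeasurable_sum => n; apply: cmeasurableM; first exact: cmeasurable_cst.
exact: cmeasurable_det_coef.
Qed.

Lemma cmeasurable_minor_sum N : cmeasurable_fun setT
  (fun p : T * T * Y => \sum_(0 <= n < N) c n * minor_coef n p.1.1 p.1.2 p.2).
Proof.
apply: cmeasurable_sum => n; apply: cmeasurableM; first exact: cmeasurable_cst.
exact: cmeasurable_minor_coef.
Qed.

Lemma cmeasurable_fredholm_minor : cmeasurable_fun setT
  (fun p : T * T * Y => fredholm_minor m setT (ky p.2) p.1.1 p.1.2 kappa).
Proof.
apply: (cmeasurable_ccvg cmeasurable_minor_sum) => p.
exact: ccvg_fredholm_minor.
Qed.

(** The integrated row expansion. By the symmetry of the tuple measure the integral of the [j]-th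
    term does not depend on [j], so the sum over [j] becomes the factor [n.+1]. *)
Lemma minor_coefS n x s y : minor_coef n.+1 x s y =
  k x s y * det_coef n.+1 y -
  n.+1%:R * cintegral m setT (fun z => k x z y * minor_coef n z s y).
Proof.
have mtc q (z : T) : measurable_fun setT (fun t : q.-tuple T => tcons (z, t)).
  by apply: (measurableT_comp (@measurable_tcons _ T q)); exact: measurable_fun_pair.
have bint q (u v : q.-tuple T -> q.+1.-tuple T) :
    measurable_fun setT u -> measurable_fun setT v ->
    cintegrable (tau q) (fun t => \det (kernel_mx (ky y) (u t) (v t))).
  move=> mu mv; apply: (cintegrable_bounded (tuple_measure_lty q)
    (M := Num.sqrt (q.+1%:R ^+ q.+1) * M ^+ q.+1)).
    exact: cmeasurable_det_kernel_mx.
  by move=> t; exact: normc_det_kernel_mx_le.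
have bint0 q : cintegrable (tau q) (fun t => \det (kernel_mx (ky y) t t)).
  apply: (cintegrable_bounded (tuple_measure_lty q)
    (M := Num.sqrt (q%:R ^+ q) * M ^+ q)).
    exact: cmeasurable_det_kernel_mx.
  by move=> t; exact: normc_det_kernel_mx_le.
pose f (p : T * n.-tuple T) :=
  k x p.1 y * \det (kernel_mx (ky y) (tcons p) (tcons (s, p.2))).
have mk1 : cmeasurable_fun setT (fun z => k x z y).
  apply: (cmeasurable_comp (g := fun z => (x, z, y)) mk).
  by apply: measurable_fun_pair => //; exact: measurable_fun_pair.
have mf : cmeasurable_fun setT f.
  apply: cmeasurableM.
    by apply: (cmeasurable_comp (g := fst) mk1).
  apply: cmeasurable_det_kernel_mx => //; first exact: measurable_tcons.
  apply: (measurableT_comp (@measurable_tcons _ T n)).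
  exact: measurable_fun_pair.
have fB p : normc (f p) <= M * (Num.sqrt (n.+1%:R ^+ n.+1) * M ^+ n.+1).
  rewrite Normc.normcM; apply: ler_pM => //; rewrite ?normc_ge0//.
  exact: normc_det_kernel_mx_le.
have intfj (j : 'I_n.+1) : cintegrable (tau n.+1) (fun t => f (extract_tnth j t)).
  apply: (cintegrable_bounded (tuple_measure_lty n.+1) _ (fun t => fB _)).
  by apply: (cmeasurable_comp mf); exact: measurable_extract_tnth.
have intfz z : cintegrable (tau n) (fun u => f (z, u)).
  apply: (cintegrable_bounded (tuple_measure_lty n) _ (fun t => fB _)).
  by apply: (cmeasurable_comp (g := fun u => (z, u)) mf); exact: measurable_fun_pair.
rewrite /minor_coef; under eq_fun do rewrite det_kernel_mx_tcons.
rewrite cintegralB; last 2 first.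
- exact: cintegrableZ.
- exact: (@cintegrable_sum _ _ _ _ _ _ (fun j t => f (extract_tnth j t))).
rewrite cintegralZ//; congr (_ - _).
rewrite (@cintegral_sum _ _ _ _ _ _ (fun j t => f (extract_tnth j t)))//.
under eq_bigr do rewrite cintegral_extract_tnth//.
rewrite sumr_const card_ord -[LHS]mulr_natl; congr (_ * cintegral _ _ _).
by apply/funext => z; rewrite -cintegralZ//; exact: bint.
Qed.

(** The relation holds exactly between partial sums, by [minor_coefS], and passes to the limit by
    dominated convergence. *)
Lemma fredholm_minorE x s y : fredholm_minor m setT (ky y) x s kappa =
  fredholm_det m setT (ky y) kappa * k x s y + kappa *
  cintegral m setT (fun z => k x z y * fredholm_minor m setT (ky y) z s kappa).
Proof.
pose SA N x s := \sum_(0 <= n < N) c n * minor_coef n x s y.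
pose SD N := \sum_(0 <= n < N) c n * det_coef n y.
have moo : (m setT < +oo)%E by rewrite ltey_eq fin_num_measure.
have mk1 : cmeasurable_fun setT (fun z => k x z y).
  apply: (cmeasurable_comp (g := fun z => (x, z, y)) mk).
  by apply: measurable_fun_pair => //; exact: measurable_fun_pair.
have mpair : measurable_fun setT (fun z : T => (z, s, y)).
  by apply: measurable_fun_pair => //; exact: measurable_fun_pair.
have mmin n : cmeasurable_fun setT (fun z => minor_coef n z s y).
  exact: (cmeasurable_comp (cmeasurable_minor_coef n) mpair).
have minI n : cintegrable m (fun z => k x z y * (c n * minor_coef n z s y)).
  apply: (cintegrable_bounded moo (M := M * ((2 * M * C) / 2 ^+ n))).
    by apply: cmeasurableM => //; apply: cmeasurableM => //; exact: cmeasurable_cst.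
  move=> z; rewrite Normc.normcM; apply: ler_pM; rewrite ?normc_ge0//.
  exact: normc_minor_coef_le.
(* The factor [n.+1] cancels against the factorial, and the extra [- kappa] turns the minus sign of
   the recursion into the plus sign of the relation. *)
have cS n z : c n.+1 * (n.+1%:R * z) = - kappa * (c n * z).
  have nz : n%:R + 1 != 0 :> R[i] by rewrite natr1 pnatr_eq0.
  have nfz : n`!%:R != 0 :> R[i] by rewrite pnatr_eq0 -lt0n fact_gt0.
  by rewrite /c exprS factS natrM; field; rewrite ?nz ?nfz ?natr1 ?nat1r ?pnatr_eq0.
have cI n : c n * cintegral m setT (fun z => k x z y * minor_coef n z s y) =
    cintegral m setT (fun z => k x z y * (c n * minor_coef n z s y)).
  (* Integrability is at hand only with the factor [c n], which vanishes for [kappa = 0] and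
     positive [n]; otherwise it is divided out. *)
  have [c0|c0] := eqVneq (c n) 0.
    by rewrite c0 mul0r; under eq_fun do rewrite mul0r mulr0; rewrite cintegral0.
  rewrite -cintegralZ.
    by congr cintegral; apply/funext => z; rewrite mulrCA.
  have := cintegrableZ (c n)^-1 (minI n).
  by under eq_fun do rewrite mulrCA mulKf//.
(* The index shift leaves one term less under the integral than outside, which does not affect the
   limits. *)
have rec N : SA N.+1 x s = SD N.+1 * k x s y +
    kappa * cintegral m setT (fun z => k x z y * SA N z s).
  rewrite /SA /SD big_nat_recl// [in RHS]big_nat_recl// minor_coef0 det_coef0.
  under eq_bigr do rewrite minor_coefS mulrBr cS.
  rewrite sumrB mulrDl mulr1 -addrA; congr (_ + _).
  rewrite mulr_suml; congr (_ + _).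
    by apply: eq_bigr => i _; rewrite mulrA mulrAC.
  under [in RHS]eq_fun do rewrite mulr_sumr.
  rewrite (@cintegral_sum _ _ _ _ _ _ (fun n z => k x z y * (c n * minor_coef n z s y)))//.
  by rewrite mulr_sumr -sumrN; apply: eq_bigr => i _; rewrite mulNr opprK cI.
have l1 := ccvg_shift (ccvg_fredholm_minor x s y).
have l2 : ccvg (fun N => SA N.+1 x s) (fredholm_det m setT (ky y) kappa * k x s y +
    kappa * cintegral m setT
      (fun z => k x z y * fredholm_minor m setT (ky y) z s kappa)).
  rewrite (_ : (fun N => _) = (fun N => SD N.+1 * k x s y +
    kappa * cintegral m setT (fun z => k x z y * SA N z s))); last first.
    by apply/funext => N; exact: rec.
  apply: ccvgD; apply: ccvgM; [|exact: ccvg_cst|exact: ccvg_cst|].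
    exact: ccvg_shift (ccvg_fredholm_det y).
  apply: (dominated_cintegral (g := fun=> M * (2 * (2 * M * C)))).
  - move=> N; apply: cmeasurableM => //.
    exact: (cmeasurable_comp (cmeasurable_minor_sum N) mpair).
  - apply: cmeasurableM => //.
    exact: (cmeasurable_comp cmeasurable_fredholm_minor mpair).
  - by move=> z; apply: ccvgM; [exact: ccvg_cst|exact: ccvg_fredholm_minor].
  - exact: finite_measure_integrable_cst.
  - move=> N z; rewrite Normc.normcM; apply: ler_pM; rewrite ?normc_ge0//.
    exact: normc_minor_sum_le.
exact: ccvg_unique l1 l2.
Qed.

End fredholm_series.

(** * The resolvent kernel *)

Section fredholm_congruence.
Context d (T : measurableType d) (R : realType).
Implicit Types (mu : {sigma_finite_measure set T -> \bar R}) (D : set T).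
Implicit Types (K : T -> T -> R[i]).

(** Comparing the integrals, and not the kernels, makes this fit both for transposing the kernel and
    for changing the measure and the domain. *)
Lemma eq_fredholm_det mu1 mu2 D1 D2 K1 K2 kappa :
  (forall n, cintegral (tuple_measure mu1 n) (@tuple_set _ T D1 n)
     (fun xi => \det (\matrix_(i < n, j < n) K1 (tnth xi i) (tnth xi j))) =
   cintegral (tuple_measure mu2 n) (@tuple_set _ T D2 n)
     (fun xi => \det (\matrix_(i < n, j < n) K2 (tnth xi i) (tnth xi j)))) ->
  fredholm_det mu1 D1 K1 kappa = fredholm_det mu2 D2 K2 kappa.
Proof.
move=> K12; rewrite /fredholm_det; apply: (congr1 (GRing.add 1)).
apply: (congr1 (fun u : nat -> R[i]^o => limn u)); apply/funext => N.
by apply: eq_bigr => n _; rewrite K12.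
Qed.

Lemma eq_fredholm_minor mu1 mu2 D1 D2 K1 K2 x1 s1 x2 s2 kappa :
  K1 x1 s1 = K2 x2 s2 ->
  (forall n, cintegral (tuple_measure mu1 n) (@tuple_set _ T D1 n)
     (fun xi => \det (\matrix_(i < n.+1, j < n.+1)
       K1 (tnth [tuple of x1 :: xi] i) (tnth [tuple of s1 :: xi] j))) =
   cintegral (tuple_measure mu2 n) (@tuple_set _ T D2 n)
     (fun xi => \det (\matrix_(i < n.+1, j < n.+1)
       K2 (tnth [tuple of x2 :: xi] i) (tnth [tuple of s2 :: xi] j)))) ->
  fredholm_minor mu1 D1 K1 x1 s1 kappa = fredholm_minor mu2 D2 K2 x2 s2 kappa.
Proof.
move=> Kxs K12; rewrite /fredholm_minor Kxs; apply: (congr1 (GRing.add _)).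
apply: (congr1 (fun u : nat -> R[i]^o => limn u)); apply/funext => N.
by apply: eq_bigr => n _; rewrite K12.
Qed.

Lemma fredholm_det_tr mu D K kappa :
  fredholm_det mu D (fun x s => K s x) kappa = fredholm_det mu D K kappa.
Proof.
apply: eq_fredholm_det => n; apply: (congr1 (cintegral _ _)); apply/funext => t.
by rewrite -det_tr; apply: (congr1 determinant); apply/matrixP => i j; rewrite !mxE.
Qed.

Lemma fredholm_minor_tr mu D K x s kappa :
  fredholm_minor mu D (fun x s => K s x) s x kappa = fredholm_minor mu D K x s kappa.
Proof.
apply: (@eq_fredholm_minor mu mu D D (fun x s => K s x) K s x x s) => [//|n].
apply: (congr1 (cintegral _ _)); apply/funext => t.
by rewrite -det_tr; apply: (congr1 determinant); apply/matrixP => i j; rewrite !mxE.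
Qed.

End fredholm_congruence.

Section resolvent_kernel.
Context d (T : measurableType d) (R : realType).
Variable m : {finite_measure set T -> \bar R}.
Implicit Types K : T -> T -> R[i].

Let moo : (m setT < +oo)%E.
Proof. by rewrite ltey_eq fin_num_measure. Qed.

Definition bounded_kernel K (B : R) :=
  cmeasurable_fun setT (fun p : T * T => K p.1 p.2) /\
  forall x s, normc (K x s) <= B.

Lemma bounded_kernel_row K B x : bounded_kernel K B ->
  cmeasurable_fun setT (K x).
Proof.
move=> [mK _]; apply: (cmeasurable_comp (g := fun s => (x, s)) mK).
exact: measurable_fun_pair.
Qed.

Lemma bounded_kernel_col K B s : bounded_kernel K B ->
  cmeasurable_fun setT (K ^~ s).
Proof.
move=> [mK _]; apply: (cmeasurable_comp (g := fun x => (x, s)) mK).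
exact: measurable_fun_pair.
Qed.

Lemma cintegrable_kernelM K B x phi : bounded_kernel K B -> cintegrable m phi ->
  cintegrable m (fun s => K x s * phi s).
Proof.
move=> bK iphi; apply: (cintegrableMl (bounded_kernel_row x bK) _ iphi).
by case: bK => _; exact.
Qed.

Lemma cmeasurable_kernel_op K B phi : bounded_kernel K B -> cintegrable m phi ->
  cmeasurable_fun setT (fun x => cintegral m setT (fun s => K x s * phi s)).
Proof.
move=> [mK _] iphi.
apply: (cmeasurable_cintegral_param m (f := fun p : T * T => K p.1 p.2 * phi p.2)).
apply: cmeasurableM => //.
exact: (cmeasurable_comp (g := snd) (cintegrable_measurable iphi)).
Qed.

Lemma normc_kernel_op_le K B phi x : bounded_kernel K B -> cintegrable m phi ->
  normc (cintegral m setT (fun s => K x s * phi s)) <=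
  2 * B * \int[m]_s normc (phi s).
Proof.
move=> bK iphi; have iK := cintegrable_kernelM x bK iphi.
have iphin := cintegrable_normc iphi.
rewrite (le_trans (normc_cintegral_le iK))// -mulrA ler_wpM2l//.
rewrite -RintegralZl//; apply: le_Rintegral => //.
- exact: cintegrable_normc.
- by have := integrableZl measurableT B iphin; apply: eq_integrable.
- by move=> s _; rewrite Normc.normcM ler_wpM2r ?normc_ge0//; case: bK => _; exact.
Qed.

Lemma cintegrable_kernel_op K B phi : bounded_kernel K B -> cintegrable m phi ->
  cintegrable m (fun x => cintegral m setT (fun s => K x s * phi s)).
Proof.
move=> bK iphi; apply: (cintegrable_bounded moo
  (M := 2 * B * \int[m]_s normc (phi s))).
  exact: cmeasurable_kernel_op bK iphi.
by move=> x; exact: normc_kernel_op_le.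
Qed.

(** Associativity of kernel composition, by Fubini. The majorant depends on [s] only, and the total
    mass is finite, so it is integrable on the product. *)
Lemma kernel_op_comp K1 K2 B1 B2 phi x : bounded_kernel K1 B1 ->
  bounded_kernel K2 B2 -> cintegrable m phi ->
  cintegral m setT (fun t => K1 x t * cintegral m setT (fun s => K2 t s * phi s)) =
  cintegral m setT (fun s => cintegral m setT (fun t => K1 x t * K2 t s) * phi s).
Proof.
move=> bK1 bK2 iphi.
have mphi := cintegrable_measurable iphi.
have iphin := cintegrable_normc iphi.
have m1 := bounded_kernel_row x bK1.
have B10 : 0 <= B1 by case: bK1 => _ /(_ x x); exact: le_trans (normc_ge0 _).
have bK12 t s : normc (K1 x t * K2 t s) <= B1 * B2.
  rewrite Normc.normcM; apply: ler_pM; rewrite ?normc_ge0//.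
    by case: bK1 => _; exact.
  by case: bK2 => _; exact.
pose F (p : T * T) := K1 x p.1 * (K2 p.1 p.2 * phi p.2).
have mF : cmeasurable_fun setT F.
  apply: cmeasurableM; first exact: (cmeasurable_comp (g := fst) m1).
  apply: cmeasurableM; first by case: bK2.
  exact: (cmeasurable_comp (g := snd) mphi).
have FB t s : normc (F (t, s)) <= B1 * B2 * normc (phi s).
  by rewrite /F mulrA Normc.normcM ler_wpM2r ?normc_ge0.
transitivity (cintegral m setT (fun t => cintegral m setT (fun s => F (t, s)))).
  congr cintegral; apply/funext => t; rewrite -cintegralZ//.
  exact: cintegrable_kernelM bK2 iphi.
rewrite (@cintegral_Fubini _ _ _ _ _ m m F).
- congr cintegral; apply/funext => s.
  rewrite mulrC -cintegralZ.
    by congr cintegral; apply/funext => t; rewrite /F /=; ring.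
  apply: (cintegrable_bounded moo _ (fun t => bK12 t s)).
  by apply: cmeasurableM => //; exact: bounded_kernel_col bK2.
- apply: (@le_cintegrable _ _ _ _ _ (fun p => B1 * B2 * normc (phi p.2))) => //.
    apply/integrable21ltyP => /=.
      apply/measurable_EFinP; apply: measurable_funM => //.
      exact: (measurableT_comp (measurable_normc mphi)).
    under eq_integral do rewrite integral_cst//.
    have iB : m.-integrable setT (EFin \o (fun s => `|B1 * B2 * normc (phi s)|)).
      apply: integrable_norm.
      by have := integrableZl measurableT (B1 * B2) iphin; apply: eq_integrable.
    rewrite ge0_integralZr//; last exact: measurable_int iB.
    rewrite lte_mul_pinfty//.
    - exact: integral_ge0.
    - exact: integrable_fin_num.
  by move=> -[t s]; exact: FB.
- by move=> t; exact: (cintegrableZ (K1 x t) (cintegrable_kernelM t bK2 iphi)).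
- move=> s; rewrite /F /=.
  apply: (cintegrable_bounded moo (M := B1 * B2 * normc (phi s))).
    apply: cmeasurableM => //; apply: cmeasurableM; last exact: cmeasurable_cst.
    exact: bounded_kernel_col bK2.
  by move=> t; exact: FB.
Qed.

Lemma bounded_kernel_comp K1 K2 B1 B2 : bounded_kernel K1 B1 ->
  bounded_kernel K2 B2 ->
  bounded_kernel (fun x s => cintegral m setT (fun z => K1 x z * K2 z s))
    (2 * (B1 * B2 * fine (m setT))).
Proof.
move=> bK1 bK2; split=> [|x s].
  apply: (cmeasurable_cintegral_param m
    (f := fun p : (T * T) * T => K1 p.1.1 p.2 * K2 p.2 p.1.2)).
  apply: cmeasurableM.
    apply: (cmeasurable_comp (g := fun p : (T * T) * T => (p.1.1, p.2)) bK1.1).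
    by apply: measurable_fun_pair => //; exact: measurableT_comp.
  apply: (cmeasurable_comp (g := fun p : (T * T) * T => (p.2, p.1.2)) bK2.1).
  by apply: measurable_fun_pair => //; exact: measurableT_comp.
apply: normc_cintegral_le_cst => // [|z].
  by apply: cmeasurableM; [exact: bounded_kernel_row bK1|exact: bounded_kernel_col bK2].
rewrite Normc.normcM; apply: ler_pM; rewrite ?normc_ge0//.
  exact: bK1.2.
exact: bK2.2.
Qed.

Variables (K N : T -> T -> R[i]) (BK BN : R) (D kappa : R[i]).
Hypotheses (bK : bounded_kernel K BK) (bN : bounded_kernel N BN).
Hypothesis D0 : D != 0.

(** The relation reads [kappa K N = N - D K] as operators. Hence [kappa K] maps [(kappa / D) N phi]
    to [(kappa / D) N phi - kappa K phi], and all terms but [phi] cancel, at every [x]. Keeping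
    [kappa K N] together avoids dividing by [kappa]. *)
Lemma resolvent_solves phi x :
  (forall x s, N x s = D * K x s + kappa * cintegral m setT (fun z => K x z * N z s)) ->
  cintegrable m phi ->
  let f := fun x => phi x + kappa * cintegral m setT (fun s => N x s / D * phi s) in
  f x - kappa * cintegral m setT (fun s => K x s * f s) = phi x.
Proof.
move=> NE iphi f.
have opD u : cintegral m setT (fun s => N u s / D * phi s) =
    D^-1 * cintegral m setT (fun s => N u s * phi s).
  rewrite -cintegralZ; last exact: cintegrable_kernelM bN iphi.
  by congr cintegral; apply/funext => s; rewrite mulrAC mulrC.
have iN := cintegrable_kernel_op bN iphi.
have KN s : kappa * cintegral m setT (fun z => K x z * N z s) = N x s - D * K x s.
  by rewrite NE addrC addKr.
have KE : kappa * cintegral m setT (fun t =>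
      K x t * cintegral m setT (fun s => N t s * phi s)) =
    cintegral m setT (fun s => N x s * phi s) -
    D * cintegral m setT (fun s => K x s * phi s).
  rewrite (kernel_op_comp x bK bN iphi) -cintegralZ; last first.
    exact: cintegrable_kernelM (bounded_kernel_comp bK bN) iphi.
  rewrite -cintegralZ; last exact: cintegrable_kernelM bK iphi.
  rewrite -cintegralB; last 2 first.
  - exact: cintegrable_kernelM bN iphi.
  - by apply: cintegrableZ; exact: cintegrable_kernelM bK iphi.
  by congr cintegral; apply/funext => s; rewrite mulrA KN mulrBl mulrA.
have fE : cintegral m setT (fun s => K x s * f s) =
    cintegral m setT (fun s => K x s * phi s) + kappa / D *
    cintegral m setT (fun t => K x t * cintegral m setT (fun s => N t s * phi s)).
  rewrite -cintegralZ; last exact: cintegrable_kernelM bK iN.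
  rewrite -cintegralD; last 2 first.
  - exact: cintegrable_kernelM bK iphi.
  - by apply: cintegrableZ; exact: cintegrable_kernelM bK iN.
  by congr cintegral; apply/funext => s; rewrite /f opD; ring.
rewrite fE /f opD mulrDr.
have -> : kappa * (kappa / D *
    cintegral m setT (fun t => K x t * cintegral m setT (fun s => N t s * phi s))) =
    kappa / D * (cintegral m setT (fun s => N x s * phi s) -
      D * cintegral m setT (fun s => K x s * phi s)).
  by rewrite -KE; ring.
by field.
Qed.

(** Applying [N] to [phi = kappa K phi] and replacing [kappa N K] by [N - D K] gives
    [N phi = N phi - D K phi]. So [K phi] vanishes at every point, and the equation itself then
    makes [phi] vanish almost everywhere. *)
Lemma resolvent_unique phi :
  (forall x s, N x s = D * K x s + kappa * cintegral m setT (fun z => N x z * K z s)) ->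
  cintegrable m phi ->
  {ae m, forall x, phi x = kappa * cintegral m setT (fun s => K x s * phi s)} ->
  {ae m, forall x, phi x = 0}.
Proof.
move=> NE iphi phiE.
have w0 x : cintegral m setT (fun s => K x s * phi s) = 0.
  have NK s : kappa * cintegral m setT (fun z => N x z * K z s) = N x s - D * K x s.
    by rewrite NE addrC addKr.
  have h1 : cintegral m setT (fun t => N x t * phi t) =
      kappa * cintegral m setT (fun t => N x t * cintegral m setT (fun s => K t s * phi s)).
    rewrite -cintegralZ; last exact: cintegrable_kernelM bN (cintegrable_kernel_op bK iphi).
    apply: ae_eq_cintegral.
    - exact: cintegrable_measurable (cintegrable_kernelM x bN iphi).
    - apply/cintegrable_measurable/cintegrableZ.
      exact: cintegrable_kernelM bN (cintegrable_kernel_op bK iphi).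
    - by apply: filterS phiE => t {1}->; rewrite mulrCA.
  have h2 : kappa * cintegral m setT (fun t =>
        N x t * cintegral m setT (fun s => K t s * phi s)) =
      cintegral m setT (fun t => N x t * phi t) -
      D * cintegral m setT (fun s => K x s * phi s).
    rewrite (kernel_op_comp x bN bK iphi) -cintegralZ; last first.
      exact: cintegrable_kernelM (bounded_kernel_comp bN bK) iphi.
    rewrite -[D * _]cintegralZ; last exact: cintegrable_kernelM bK iphi.
    rewrite -cintegralB; last 2 first.
    - exact: cintegrable_kernelM bN iphi.
    - by apply: cintegrableZ; exact: cintegrable_kernelM bK iphi.
    by congr cintegral; apply/funext => s; rewrite mulrA NK mulrBl mulrA.
  have : D * cintegral m setT (fun s => K x s * phi s) = 0.
    rewrite h2 in h1.
    by rewrite -[LHS](subKr (cintegral m setT (fun t => N x t * phi t))) -h1 subrr.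
  by move/eqP; rewrite mulf_eq0 (negbTE D0) => /eqP.
by apply: filterS phiE => x ->; rewrite w0 mulr0.
Qed.

End resolvent_kernel.

(** * The equation over a finite measure space *)

(** The extended inverse is [+oo] at [0], hence the case distinction. *)
Lemma measurable_inve_EFin d (T : measurableType d) (R : realType) (r : T -> R) :
  measurable_fun setT r -> measurable_fun setT (fun y => ((r y)%:E)^-1)%E.
Proof.
move=> mr; under eq_fun do rewrite inver.
apply: measurable_fun_ifT => //; first exact: measurable_fun_eqr.
by apply/measurable_EFinP; exact: (measurableT_comp (@measurable_invr R) mr).
Qed.

Lemma measurable_sqnorm d (T : measurableType d) (R : realType) (f : T -> R[i]) :
  cmeasurable_fun setT f -> measurable_fun setT (fun x => sqnorm (f x)).
Proof. by move=> mf; apply/measurable_EFinP; exact: measurable_sqr_normc. Qed.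

Lemma sqnorm_ge0 (R : realType) (z : R[i]) : (0 <= sqnorm z)%E.
Proof. by rewrite lee_fin sqr_ge0. Qed.

Lemma sqnorm_eq0 (R : realType) (z : R[i]) : (sqnorm z == 0)%E = (z == 0).
Proof. by rewrite eqe sqrf_eq0 normc_eq0. Qed.

Lemma sqr_normcD_le (R : realType) (z w : R[i]) :
  normc (z + w) ^+ 2 <= 2 * normc z ^+ 2 + 2 * normc w ^+ 2.
Proof.
have h := le_normcD z w; have h0 := normc_ge0 (z + w).
have hz := normc_ge0 z; have hw := normc_ge0 w.
move: h h0 hz hw; set a := normc (z + w); set b := normc z; set c := normc w => *.
have hsq := sqr_ge0 (b - c).
nra.
Qed.

Section finite_measure_L2.
Context d (T : measurableType d) (R : realType).
Variable m : {finite_measure set T -> \bar R}.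

(* Cauchy-Schwarz; the summand [1] avoids a case distinction on [m setT = 0]. *)
Lemma sqr_Rintegral_le (f : T -> R) : m.-integrable setT (EFin \o f) ->
  m.-integrable setT (EFin \o (fun x => f x ^+ 2)) ->
  (\int[m]_x f x) ^+ 2 <= (fine (m setT) + 1) * \int[m]_x f x ^+ 2.
Proof.
move=> if1 if2; set I := \int[m]_x f x; set Q := \int[m]_x f x ^+ 2.
set u := fine (m setT).
have u0 : 0 <= u by rewrite fine_ge0.
(* Up to the summand [1], [c] is the mean of [f]; the estimate results from expanding the
   nonnegative integral of [(f x - c) ^+ 2]. *)
pose c := I / (u + 1).
have iZ : m.-integrable setT (EFin \o (fun x => - (2 * c) * f x)).
  by have := integrableZl measurableT (- (2 * c)) if1; apply: eq_integrable.
have iC : m.-integrable setT (EFin \o (fun=> c ^+ 2)).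
  exact: finite_measure_integrable_cst.
have iS : m.-integrable setT (EFin \o (fun x => f x ^+ 2 + - (2 * c) * f x)).
  by have := integrableD measurableT if2 iZ; apply: eq_integrable.
have : 0 <= \int[m]_x (f x ^+ 2 + - (2 * c) * f x + c ^+ 2).
  apply: Rintegral_ge0 => x _.
  by rewrite (_ : _ + _ = (f x - c) ^+ 2) ?sqr_ge0//; ring.
rewrite RintegralD// RintegralD// RintegralZl// Rintegral_cst// -/I -/Q -/u => h.
have u1 : 0 < u + 1 by rewrite ltr_wpDl.
have cI : I = c * (u + 1) by rewrite /c mulfVK// gt_eqF.
rewrite cI in h *; nra.
Qed.

(** From [normc z <= 1 + normc z ^+ 2], the constant [1] being integrable for a finite measure. *)
Lemma cintegrable_sqnorm (f : T -> R[i]) : cmeasurable_fun setT f ->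
  (\int[m]_x sqnorm (f x) < +oo)%E ->
  cintegrable m f /\ m.-integrable setT (EFin \o (fun x => normc (f x) ^+ 2)).
Proof.
move=> mf foo.
have i2 : m.-integrable setT (EFin \o (fun x => normc (f x) ^+ 2)).
  apply/integrableP; split; first exact: measurable_sqnorm.
  apply: le_lt_trans foo; rewrite le_eqVlt; apply/orP; left; apply/eqP.
  by apply: eq_integral => x _; rewrite gee0_abs ?sqnorm_ge0.
split=> //; apply: (@le_cintegrable _ _ _ _ _ (fun x => 1 + normc (f x) ^+ 2)) => //.
  have i1 : m.-integrable setT (EFin \o (fun=> 1)) by exact: finite_measure_integrable_cst.
  by have := integrableD measurableT i1 i2; apply: eq_integrable.
move=> x; have := normc_ge0 (f x); set a := normc _ => a0; nra.
Qed.

Lemma sqr_Rintegral_normc_le (f : T -> R[i]) : cintegrable m f ->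
  m.-integrable setT (EFin \o (fun x => normc (f x) ^+ 2)) ->
  ((((\int[m]_x normc (f x)) ^+ 2)%:E : \bar R) <=
    (fine (m setT) + 1)%:E * \int[m]_x sqnorm (f x))%E.
Proof.
move=> if1 if2; have := sqr_Rintegral_le (cintegrable_normc if1) if2.
rewrite -lee_fin => /le_trans; apply.
by rewrite EFinM /Rintegral fineK//; exact: (integrable_fin_num measurableT if2).
Qed.

Lemma ae_product_snd (P : T -> Prop) : {ae m, forall y, P y} ->
  {ae (m \x m)%E, forall p, P p.2}.
Proof.
move=> [N [mN N0 PN]]; exists (setT `*` N); split.
- exact: measurableX.
- have -> : (m \x m)%E (setT `*` N) = (m setT * m N)%E by exact: product_measure1E.
  by rewrite N0 mule0.
- by move=> p /= nP; split=> //; exact: PN.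
Qed.

Lemma ae_product_section (Q : T * T -> Prop) : {ae (m \x m)%E, forall p, Q p} ->
  {ae m, forall y, {ae m, forall x, Q (x, y)}}.
Proof.
move=> [N [mN N0 QN]].
(* The product [\x] integrates the sections at fixed first coordinate; by uniqueness it equals
   [\x^], which integrates those at fixed [y]. *)
have N0' : (\int[m]_y (m \o ysection N) y = 0)%E.
  rewrite -[RHS]N0.
  rewrite (@product_measure_unique _ _ _ _ _ m m (m \x^ m)%E)// => A B mA mB.
  exact: product_measure2E.
have mS := measurable_fun_ysection m mN.
have S0 : (\int[m]_y `|(m \o ysection N) y| = 0)%E.
  by rewrite -[RHS]N0'; apply: eq_integral => y _; rewrite gee0_abs.
have := (ae_eq_integral_abs m measurableT mS).1 S0; apply: filterS => y /(_ I) NS0.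
exists (ysection N y); split => //; first exact: measurable_ysection.
by move=> x /= nQ; rewrite /ysection/= inE; exact: QN.
Qed.

End finite_measure_L2.

Section partial_integral_equation.
Context d (T : measurableType d) (R : realType).
Variable m : {finite_measure set T -> \bar R}.
Variables (kappa : R[i]) (M : R) (k : T -> T -> T -> R[i]).
Hypothesis mk : cmeasurable_fun setT (fun p : T * T * T => k p.1.1 p.1.2 p.2).
Hypothesis kM : forall x s y, normc (k x s y) <= M.
Hypothesis M0 : 0 <= M.

Let Dv y := fredholm_det m setT (fun x s => k x s y) kappa.
Let Mn x s y := fredholm_minor m setT (fun x s => k x s y) x s kappa.

Lemma fredholm_theory : exists BN,
  [/\ forall x s y, normc (Mn x s y) <= BN,
      cmeasurable_fun setT Dv,
      cmeasurable_fun setT (fun p : T * T * T => Mn p.1.1 p.1.2 p.2),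
      (forall y x s, Mn x s y = Dv y * k x s y + kappa *
        cintegral m setT (fun z => k x z y * Mn z s y)) &
      (forall y x s, Mn x s y = Dv y * k x s y + kappa *
        cintegral m setT (fun z => Mn x z y * k z s y))].
Proof.
have [C hC] := geometric_bound (normc kappa * M * fine (m setT)).
exists (2 * (2 * (2 * M * C))); split.
- by move=> x s y; exact: (normc_fredholm_minor_le M0 hC mk kM).
- exact: (cmeasurable_fredholm_det M0 hC mk kM).
- exact: (cmeasurable_fredholm_minor M0 hC mk kM).
- by move=> y x s; exact: (fredholm_minorE M0 hC mk kM).
move=> y x s.
(* The same [M] bounds the transposed kernel, so [hC] applies to it unchanged. *)
pose k' (x s y : T) := k s x y.
have mk' : cmeasurable_fun setT (fun p : T * T * T => k' p.1.1 p.1.2 p.2).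
  apply: (cmeasurable_comp (g := fun p : T * T * T => (p.1.2, p.1.1, p.2)) mk).
  apply/measurable_fun_pair => //; apply/measurable_fun_pair => //;
  exact: measurableT_comp.
have := fredholm_minorE M0 hC mk' (fun x s y => kM s x y) s x y.
rewrite /k' /Mn /Dv fredholm_det_tr fredholm_minor_tr => ->.
congr (_ + _ * cintegral _ _ _); apply/funext => z.
by rewrite fredholm_minor_tr mulrC.
Qed.

Let pT f (p : T * T) := cintegral m setT (fun s => k p.1 s p.2 * f (s, p.2)).
Let pB g (p : T * T) :=
  cintegral m setT (fun s => Mn p.1 s p.2 / Dv p.2 * g (s, p.2)).

Lemma cmeasurable_section_l (g : T * T -> R[i]) y : cmeasurable_fun setT g ->
  cmeasurable_fun setT (fun s => g (s, y)).
Proof.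
move=> mg; apply: (cmeasurable_comp (g := fun s => (s, y)) mg).
exact: measurable_fun_pair.
Qed.

Lemma measurable_proj3 : measurable_fun setT (fun q : T * T * T => (q.2, q.1.2)).
Proof. by apply: measurable_fun_pair => //; exact: measurableT_comp. Qed.

Lemma measurable_perm3 : measurable_fun setT (fun q : T * T * T => (q.1.1, q.2, q.1.2)).
Proof.
apply: measurable_fun_pair; last exact: measurableT_comp.
by apply: measurable_fun_pair => //; exact: measurableT_comp.
Qed.

Lemma cmeasurable_pB g : cmeasurable_fun setT g -> cmeasurable_fun setT (pB g).
Proof.
have [BN [_ mD mM _ _]] := fredholm_theory.
move=> mg; apply: (cmeasurable_cintegral_param m
  (f := fun q : (T * T) * T => Mn q.1.1 q.2 q.1.2 / Dv q.1.2 * g (q.2, q.1.2))).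
apply: cmeasurableM; last exact: (cmeasurable_comp mg measurable_proj3).
apply: cmeasurableM; first exact: (cmeasurable_comp mM measurable_perm3).
apply: (cmeasurable_comp (g := fun q : (T * T) * T => q.1.2) (cmeasurableV mD)).
exact: measurableT_comp.
Qed.

Let G (g : T * T -> R[i]) (y : T) : \bar R := (\int[m]_s sqnorm (g (s, y)))%E.

(** The bound is arranged to hold at every [p], whether or not the determinant vanishes or the
    section of [g] is square integrable, so that it can be integrated without an exceptional set. *)
Lemma sqnorm_pB_le g : cmeasurable_fun setT g -> exists2 A, 0 <= A &
  forall p, (sqnorm (pB g p) <= A%:E * (G g p.2 / sqnorm (Dv p.2)))%E.
Proof.
move=> mg; have [BN [MB mD mM _ _]] := fredholm_theory.
have u0 : 0 < fine (m setT) + 1 by rewrite ltr_wpDl// fine_ge0.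
(* [4] is the square of the [2] in [normc_kernel_op_le], the last factor is that of Cauchy-Schwarz,
   and the [1] added to [BN ^+ 2] makes the constant positive, so that its product with [+oo] is
   [+oo]. *)
exists (4 * (BN ^+ 2 + 1) * (fine (m setT) + 1)).
  by rewrite mulr_ge0 ?(ltW u0)// mulr_ge0// addr_ge0// sqr_ge0.
move=> [x y] /=; have G0 : (0 <= G g y)%E by apply: integral_ge0 => s _; exact: sqnorm_ge0.
have A0 : 0 < 4 * (BN ^+ 2 + 1) * (fine (m setT) + 1).
  by rewrite mulr_gt0// mulr_gt0// ltr_wpDl// sqr_ge0.
(* Here [0^-1] is [0] in [R[i]], on the left, and [+oo] in [\bar R], on the right. *)
have [D0|D0] := eqVneq (Dv y) 0.
  rewrite /pB /= D0; under eq_fun do rewrite invr0 mulr0 mul0r.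
  rewrite cintegral0 /sqnorm !Normc.normc0 expr0n/=.
  rewrite mule_ge0 ?lee_fin ?(ltW A0)// mule_ge0// inve_ge0//.
have nD0 : 0 < normc (Dv y) ^+ 2.
  by rewrite exprn_gt0// lt_neqAle normc_ge0 eq_sym normc_eq0 D0.
have invE : (sqnorm (Dv y))^-1%E = ((normc (Dv y) ^+ 2)^-1)%:E.
  by rewrite inver gt_eqF.
have [Goo|] := eqVneq (G g y) +oo%E.
  rewrite Goo invE gt0_mulye ?lte_fin ?invr_gt0// gt0_muley ?lte_fin//.
  by rewrite leey.
rewrite -ltey => Glt.
have [ig ig2] := cintegrable_sqnorm (cmeasurable_section_l y mg) Glt.
have bK : bounded_kernel (fun x s => Mn x s y / Dv y) (BN / normc (Dv y)).
  split=> [|u v].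
    apply: cmeasurableM; last exact: cmeasurable_cst.
    apply: (cmeasurable_comp (g := fun p : T * T => (p, y)) mM).
    exact: measurable_fun_pair.
  by rewrite Normc.normcM Normc.normcV ler_wpM2r ?invr_ge0 ?normc_ge0.
have := normc_kernel_op_le x bK ig.
have := sqr_Rintegral_normc_le ig ig2; rewrite -/(G g y).
have Gfin : G g y \is a fin_num by rewrite ge0_fin_numE.
rewrite invE -(fineK Gfin) -!EFinM !lee_fin.
have gG0 : 0 <= fine (G g y) by rewrite fine_ge0.
set I := \int[m]_s normc _; set Q := fine (G g y) in gG0 *.
set u := fine (m setT) + 1 in u0 A0 *.
move=> h1 h2.
have h3 : normc (pB g (x, y)) ^+ 2 <= (2 * (BN / normc (Dv y)) * I) ^+ 2.
  by rewrite ler_pXn2r ?nnegrE ?normc_ge0// (le_trans _ h2)// normc_ge0.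
apply: (le_trans h3).
have -> : (2 * (BN / normc (Dv y)) * I) ^+ 2 =
    4 * BN ^+ 2 * I ^+ 2 / (normc (Dv y) ^+ 2).
  by field; rewrite normc_eq0.
rewrite mulrA ler_pM2r ?invr_gt0//.
apply: (@le_trans _ _ (4 * BN ^+ 2 * (u * Q))).
  by rewrite ler_wpM2l// mulr_ge0// sqr_ge0.
have uQ : 0 <= u * Q by rewrite mulr_ge0// ltW.
have := sqr_ge0 BN; nra.
Qed.

Lemma ge0_integral_snd (H : T -> \bar R) : measurable_fun setT H ->
  (forall y, (0 <= H y)%E) -> (\int[m]_y H y < +oo)%E ->
  (\int[m \x m]_p H p.2 < +oo)%E.
Proof.
move=> mH H0 Hoo.
have mH2 : measurable_fun setT (fun p : T * T => H p.2) by exact: measurableT_comp.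
rewrite (fubini_tonelli2 (fun p : T * T => H p.2))// /fubini_G /=.
rewrite (eq_integral (fun y => H y * m setT)%E); last first.
  by move=> y _; exact: (integral_cst m measurableT (H y)).
rewrite ge0_integralZr// lte_mul_pinfty//.
- exact: integral_ge0.
- by rewrite ge0_fin_numE// integral_ge0.
- by rewrite ltey_eq fin_num_measure.
Qed.

Lemma measurable_weight g : cmeasurable_fun setT g ->
  measurable_fun setT (fun y => G g y / sqnorm (Dv y))%E.
Proof.
move=> mg; have [BN [_ mD _ _ _]] := fredholm_theory.
have mG : measurable_fun setT (G g).
  apply: (measurable_fun_fubini_tonelli_G (m1 := m) (fun p => sqnorm (g p))).
    exact: measurable_sqnorm.
  by move=> p; exact: sqnorm_ge0.
apply: emeasurable_funM => //.
by apply: measurable_inve_EFin; exact: measurable_sqr_normc.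
Qed.

Lemma pB_sqnorm_lty g : cmeasurable_fun setT g ->
  (\int[m]_y (G g y / sqnorm (Dv y)) < +oo)%E ->
  (\int[m \x m]_p sqnorm (pB g p) < +oo)%E.
Proof.
move=> mg hoo; have [A A0 hA] := sqnorm_pB_le mg.
have G0 y : (0 <= G g y)%E by apply: integral_ge0 => s _; exact: sqnorm_ge0.
have mH : measurable_fun setT (fun y => A%:E * (G g y / sqnorm (Dv y)))%E.
  by apply: measurable_funeM; exact: measurable_weight.
have H0 y : (0 <= A%:E * (G g y / sqnorm (Dv y)))%E.
  by rewrite mule_ge0// mule_ge0// inve_ge0 sqnorm_ge0.
apply: (@le_lt_trans _ _ (\int[m \x m]_p (A%:E * (G g p.2 / sqnorm (Dv p.2)))))%E.
  apply: ge0_le_integral => //.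
  - by move=> p _; exact: sqnorm_ge0.
  - by apply: measurable_sqnorm; exact: cmeasurable_pB.
  - exact: (measurableT_comp mH measurable_snd).
apply: (ge0_integral_snd mH) => //.
rewrite ge0_integralZl//.
- by rewrite lte_mul_pinfty// lee_fin.
- exact: measurable_weight.
- by move=> y _; rewrite mule_ge0// inve_ge0 sqnorm_ge0.
Qed.

Lemma sqnormD_lty (f g : T * T -> R[i]) (c : R[i]) : cmeasurable_fun setT f ->
  cmeasurable_fun setT g -> (\int[m \x m]_p sqnorm (f p) < +oo)%E ->
  (\int[m \x m]_p sqnorm (g p) < +oo)%E ->
  (\int[m \x m]_p sqnorm (f p + c * g p)%R < +oo)%E.
Proof.
move=> mf mg foo goo.
have msf := measurable_sqnorm mf; have msg := measurable_sqnorm mg.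
apply: (@le_lt_trans _ _ (\int[m \x m]_p
    (2%:E * sqnorm (f p) + (2 * normc c ^+ 2)%:E * sqnorm (g p))))%E.
  apply: ge0_le_integral => //.
  - by move=> p _; exact: sqnorm_ge0.
  - apply: measurable_sqnorm; apply: cmeasurableD => //.
    by apply: cmeasurableM => //; exact: cmeasurable_cst.
  - by apply: emeasurable_funD; exact: measurable_funeM.
  - move=> p _; rewrite -!EFinM -EFinD lee_fin.
    apply: (le_trans (sqr_normcD_le _ _)).
    by rewrite Normc.normcM exprMn [X in _ + X <= _]mulrA.
rewrite ge0_integralD//; last 4 first.
- by move=> p _; rewrite mule_ge0// sqnorm_ge0.
- exact: measurable_funeM.
- by move=> p _; rewrite mule_ge0 ?sqnorm_ge0// lee_fin mulr_ge0// sqr_ge0.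
- exact: measurable_funeM.
have c0 : 0 <= 2 * normc c ^+ 2 by rewrite mulr_ge0// sqr_ge0.
rewrite ge0_integralZl//; last by move=> p _; exact: sqnorm_ge0.
rewrite ge0_integralZl//; last by move=> p _; exact: sqnorm_ge0.
by rewrite lte_add_pinfty// lte_mul_pinfty.
Qed.

(** By Tonelli [G g] has a finite integral, so it is finite almost everywhere; there the section is
    square integrable, hence integrable. *)
Lemma ae_section_sqnorm_lty g : cmeasurable_fun setT g ->
  (\int[m \x m]_p sqnorm (g p) < +oo)%E ->
  {ae m, forall y, cintegrable m (fun s => g (s, y))}.
Proof.
move=> mg goo; have msg := measurable_sqnorm mg.
have mG : measurable_fun setT (G g).
  by apply: (measurable_fun_fubini_tonelli_G (m1 := m) (fun p => sqnorm (g p))) => // p;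
    exact: sqnorm_ge0.
have G0 y : (0 <= G g y)%E by apply: integral_ge0 => s _; exact: sqnorm_ge0.
have iG : m.-integrable setT (G g).
  apply/integrableP; split => //.
  rewrite (eq_integral (G g)); last by move=> y _; rewrite gee0_abs.
  by rewrite -[ltLHS](fubini_tonelli2 (fun p => sqnorm (g p)))// => p; exact: sqnorm_ge0.
have := integrable_ae measurableT iG; apply: filterS => y /(_ I) Gfin.
apply: (cintegrable_sqnorm (cmeasurable_section_l y mg) _).1.
by move: Gfin; rewrite ge0_fin_numE.
Qed.

Hypothesis D0 : {ae m, forall y, Dv y != 0}.

Lemma partial_integral_solution g : cmeasurable_fun setT g ->
  (\int[m \x m]_p sqnorm (g p) < +oo)%E ->
  (\int[m]_y (G g y / sqnorm (Dv y)) < +oo)%E ->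
  let f := fun p => g p + kappa * pB g p in
  [/\ cmeasurable_fun setT f, (\int[m \x m]_p sqnorm (f p) < +oo)%E &
    {ae (m \x m)%E, forall p, f p - kappa * pT f p = g p}].
Proof.
move=> mg goo hoo f; have mB := cmeasurable_pB mg.
have [BN [MB mD mM h1 h2]] := fredholm_theory.
split.
- by apply: cmeasurableD => //; apply: cmeasurableM => //; exact: cmeasurable_cst.
- by apply: sqnormD_lty => //; exact: pB_sqnorm_lty.
(* For almost every [y] the equation holds at all [x], so the exceptional set lies in a cylinder
   over a null set. *)
have key : {ae m, forall y, forall x, f (x, y) - kappa * pT f (x, y) = g (x, y)}.
  apply: filterS2 D0 (ae_section_sqnorm_lty mg goo) => y Dy ig x.
  have bK : bounded_kernel (fun x s => k x s y) M.
    split=> //; apply: (cmeasurable_comp (g := fun p : T * T => (p, y)) mk).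
    exact: measurable_fun_pair.
  have bN : bounded_kernel (fun x s => Mn x s y) BN.
    split=> //; apply: (cmeasurable_comp (g := fun p : T * T => (p, y)) mM).
    exact: measurable_fun_pair.
  exact: (@resolvent_solves _ _ _ m _ _ _ _ (Dv y) kappa bK bN Dy (fun s => g (s, y)) x (h1 y)).
by apply: filterS (ae_product_snd key) => -[x y] /= h; exact: h.
Qed.

Lemma partial_integral_unique h : cmeasurable_fun setT h ->
  (\int[m \x m]_p sqnorm (h p) < +oo)%E ->
  {ae (m \x m)%E, forall p, h p - kappa * pT h p = 0} ->
  {ae (m \x m)%E, forall p, h p = 0}.
Proof.
move=> mh hoo hE; have [BN [MB mD mM h1 h2]] := fredholm_theory.
have msh := measurable_sqnorm mh.
have key : {ae m, forall y, {ae m, forall x, h (x, y) = 0}}.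
  have := ae_product_section hE.
  apply: filterS3 D0 (ae_section_sqnorm_lty mh hoo) => y Dy ih hy.
  have bK : bounded_kernel (fun x s => k x s y) M.
    split=> //; apply: (cmeasurable_comp (g := fun p : T * T => (p, y)) mk).
    exact: measurable_fun_pair.
  have bN : bounded_kernel (fun x s => Mn x s y) BN.
    split=> //; apply: (cmeasurable_comp (g := fun p : T * T => (p, y)) mM).
    exact: measurable_fun_pair.
  apply: (@resolvent_unique _ _ _ m _ _ _ _ (Dv y) kappa bK bN Dy (fun s => h (s, y)) (h2 y) ih).
  by apply: filterS hy => x /eqP; rewrite subr_eq0 => /eqP.
(* Vanishing on almost every section becomes vanishing almost everywhere on the product through this
   integral, which Tonelli computes section by section. *)
have h0 : (\int[m \x m]_p `|sqnorm (h p)| = 0)%E.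
  rewrite (eq_integral (fun p => sqnorm (h p))); last first.
    by move=> p _; rewrite gee0_abs// sqnorm_ge0.
  rewrite (fubini_tonelli2 (fun p => sqnorm (h p)))//; last by move=> p; exact: sqnorm_ge0.
  rewrite -[RHS](integral0 m setT); apply: ge0_ae_eq_integral => //.
  - by apply: (measurable_fun_fubini_tonelli_G (m1 := m) (fun p => sqnorm (h p))) => // p;
    exact: sqnorm_ge0.
  - by move=> y _; apply: integral_ge0 => x _; exact: sqnorm_ge0.
  apply: filterS key => y hy _; rewrite /fubini_G -[RHS](integral0 m setT).
  apply: ge0_ae_eq_integral => //.
  - by apply: measurable_sqnorm; exact: cmeasurable_section_l.
  - by move=> x _; exact: sqnorm_ge0.
  - by apply: filterS hy => x /= -> _; apply/eqP; rewrite sqnorm_eq0.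
have := (ae_eq_integral_abs (m \x m)%E measurableT msh).1 h0.
by apply: filterS => p /(_ I) /eqP; rewrite sqnorm_eq0 => /eqP.
Qed.

Lemma partial_integral_injective f h g :
  cmeasurable_fun setT f -> cmeasurable_fun setT h ->
  (\int[m \x m]_p sqnorm (f p) < +oo)%E ->
  (\int[m \x m]_p sqnorm (h p) < +oo)%E ->
  {ae (m \x m)%E, forall p, f p - kappa * pT f p = g p} ->
  {ae (m \x m)%E, forall p, h p - kappa * pT h p = g p} ->
  {ae (m \x m)%E, forall p, h p = f p}.
Proof.
move=> mf mh foo hoo fE hE.
(* The difference is written in the form that [sqnormD_lty] accepts. *)
pose u p := h p + -1 * f p.
have mu : cmeasurable_fun setT u.
  by apply: cmeasurableD => //; apply: cmeasurableM => //; exact: cmeasurable_cst.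
suff : {ae (m \x m)%E, forall p, u p = 0}.
  by apply: filterS => p /eqP; rewrite /u mulN1r subr_eq0 => /eqP.
apply: partial_integral_unique => //; first exact: sqnormD_lty.
(* Linearity of the integral needs both sections to be integrable, hence only almost every [y]. *)
have pTu : {ae (m \x m)%E, forall p, pT u p = pT h p - pT f p}.
  have : {ae m, forall y, forall x, pT u (x, y) = pT h (x, y) - pT f (x, y)}.
    apply: filterS2 (ae_section_sqnorm_lty mh hoo) (ae_section_sqnorm_lty mf foo) => y ih if_ x.
    have bK : bounded_kernel (fun x s => k x s y) M.
      split=> //; apply: (cmeasurable_comp (g := fun p : T * T => (p, y)) mk).
      exact: measurable_fun_pair.
    rewrite /pT /= -cintegralB; last 2 first.
    - exact: (cintegrable_kernelM x bK ih).
    - exact: (cintegrable_kernelM x bK if_).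
    by congr cintegral; apply/funext => s; rewrite /u; ring.
  by move/ae_product_snd; apply: filterS => -[x y] /= e; exact: e.
apply: filterS3 fE hE pTu => p e1 e2 e3; rewrite e3 /u.
rewrite (_ : _ - _ = (h p - kappa * pT h p) - (f p - kappa * pT f p)); last by ring.
by rewrite e1 e2 subrr.
Qed.

End partial_integral_equation.

(** * Continuous kernels on the cube *)

Section continuous_parts.
Context {R : realType} {X : Type} (F : set_system X).
Context {FF : Filter F}.

Lemma cvg_lipschitz_complex (P : R[i] -> R) (u : X -> R[i]^o) (z : R[i]^o) :
  (forall x y, `|P x - P y| <= normc (x - y)) ->
  u @ F --> z -> P (u t) @[t --> F] --> P z.
Proof.
move=> PL /cvgrPdist_lt uz; apply/cvgrPdist_lt => e e0.
have := uz e%:C; rewrite ltcR => /(_ e0); apply: filterS => t.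
by rewrite normcC ltcR; exact: le_lt_trans (PL _ _).
Qed.

Lemma cvg_Re (u : X -> R[i]^o) (z : R[i]^o) : u @ F --> z ->
  Re (u t) @[t --> F] --> Re z.
Proof. by apply: cvg_lipschitz_complex => x y; rewrite -ReB normr_Re_le. Qed.

Lemma cvg_Im (u : X -> R[i]^o) (z : R[i]^o) : u @ F --> z ->
  Im (u t) @[t --> F] --> Im z.
Proof. by apply: cvg_lipschitz_complex => x y; rewrite -ImB normr_Im_le. Qed.

End continuous_parts.

(** Nothing is asked of [h]: a preimage under [h \o q] is a countable union of fibres of [q]. *)
Lemma measurable_countable_comp d (P : measurableType d) (R : realType)
    (W : countType) (q : P -> W) (h : W -> R) :
  (forall w, measurable (q @^-1` [set w])) -> measurable_fun setT (h \o q).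
Proof.
move=> mq _ B mB; rewrite setTI.
have -> : (h \o q) @^-1` B =
    \bigcup_w (if `[< B (h w) >] then q @^-1` [set w] else set0).
  apply/seteqP; split=> [p Bp|p [w _]].
    by exists (q p) => //; case: asboolP.
  by case: asboolP => // Bw qp; rewrite /= in qp; rewrite /preimage /= qp.
apply: countable_bigcupT_measurable => // w.
by case: asboolP.
Qed.

Section cube.
Variables (R : realType) (nu : nat) (a b : R).
Local Notation Rnu := 'rV[R]_nu.
Local Notation Omega := (cube nu a b).
Local Notation Omega3 := (Omega `*` Omega `*` Omega).

Lemma itvccE (x : R) : `[a, b]%classic x <-> a <= x <= b.
Proof. by rewrite /= in_itv. Qed.

Lemma measurable_cube : measurable Omega.
Proof.
rewrite (_ : Omega = \big[setI/setT]_(i < nu)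
    ((fun x : Rnu => x ord0 i : measurableTypeR R) @^-1` `[a, b])).
  apply: bigsetI_measurable => i _.
  rewrite -[X in measurable X]setTI.
  exact: (@measurable_rV_coord R nu i measurableT _ (measurable_itv `[a, b])).
apply/seteqP; split=> x.
  move=> Dx; elim/big_ind : _ => // i _.
  by rewrite /preimage /= in_itv /=; exact: Dx.
by move=> + i; rewrite (bigD1 i)//= => -[]; rewrite /preimage /= in_itv.
Qed.

(** The cube is a power of [[a, b]], so its measure is the total mass of the corresponding power of
    the restricted Lebesgue measure. *)
Lemma cube_lty : (lebesgue_rV Omega < +oo)%E.
Proof.
have mI : measurable (`[a, b] : set (measurableTypeR R)) by exact: measurable_itv.
have Ioo : (@lebesgue_measure R `[a, b] < +oo)%E.
  by rewrite lebesgue_measure_itv; case: ifP => // _; rewrite -EFinD ltry.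
pose m : {finite_measure set (measurableTypeR R) -> \bar R} :=
  mfrestr mI Ioo.
suff : lebesgue_rV Omega = tuple_measure m nu setT.
  by move=> ->; rewrite tuple_measure_setT ltry.
rewrite (tuple_measure_restricted (mu := @lebesgue_measure R) mI)// setTI.
apply: (congr1 (tuple_measure (@lebesgue_measure R) nu)).
apply/seteqP; split=> t; rewrite /preimage /= => h i.
  by apply/itvccE; have := h i; rewrite mxE.
by rewrite mxE; apply/itvccE; exact: h.
Qed.

Lemma compact_cube : compact Omega.
Proof.
have -> : Omega = [set v : Rnu | forall i, `[a, b]%classic (v ord0 i)].
  by apply/seteqP; split=> x h i; have := h i; rewrite /= in_itv.
by apply: (@rV_compact R nu (fun=> `[a, b]%classic)) => i; exact: segment_compact.
Qed.

(** Coordinates are rounded down on a grid of mesh 1/(n+1) anchored at [a], so that points of the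
    cube stay in it and continuity relative to the cube applies. The index is kept apart from the
    grid point because it ranges over a countable type. *)
Definition grid_index n (x : Rnu) : 'rV[int]_nu :=
  \row_i Num.floor ((x ord0 i - a) * n.+1%:R).

Definition grid_point n (z : 'rV[int]_nu) : Rnu :=
  \row_i (a + (z ord0 i)%:~R / n.+1%:R).

Lemma measurable_grid_index n z : measurable (grid_index n @^-1` [set z]).
Proof.
rewrite (_ : _ @^-1` _ = \big[setI/setT]_(i < nu)
    ((fun x : Rnu => (x ord0 i - a) * n.+1%:R : measurableTypeR R) @^-1`
      `[(z ord0 i)%:~R, (z ord0 i + 1)%:~R[)).
  apply: bigsetI_measurable => i _.
  rewrite -[X in measurable X]setTI.
  have mc : measurable_fun setT (fun x : Rnu => (x ord0 i - a) * n.+1%:R : measurableTypeR R).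
    apply: measurable_funM => //; apply: measurable_funB => //.
    exact: measurable_rV_coord.
  by apply: mc => //; exact: measurable_itv.
apply/seteqP; split=> x.
  move=> /= <-; elim/big_ind : _ => // i _.
  by rewrite /preimage /= in_itv /= mxE floor_itv.
move=> h; apply/rowP => i; rewrite mxE; apply/eqP; rewrite floor_eq.
by move: h; rewrite (bigD1 i)//= => -[]; rewrite /preimage /= in_itv.
Qed.

Lemma grid_point_itv n x i : Omega x ->
  a <= grid_point n (grid_index n x) ord0 i <= x ord0 i /\
  x ord0 i - grid_point n (grid_index n x) ord0 i <= n.+1%:R^-1.
Proof.
move=> /(_ i) /andP[ax xb]; rewrite !mxE.
have n0 : 0 < n.+1%:R :> R by rewrite ltr0n.
set t := (x ord0 i - a) * n.+1%:R.
have t0 : 0 <= t by rewrite mulr_ge0 ?subr_ge0.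
have xE : x ord0 i = a + t / n.+1%:R by rewrite /t mulfK ?gt_eqF//; ring.
have /andP[f1 f2] := floor_itv t.
split.
  rewrite lerDl divr_ge0//; last by rewrite ler0z floor_ge0.
  by rewrite xE lerD2l ler_pM2r ?invr_gt0.
rewrite xE (_ : _ - _ = (t - (Num.floor t)%:~R) / n.+1%:R); last by ring.
rewrite ler_pdivrMr// mulVf ?gt_eqF// lerBlDl.
by move: f2; rewrite intrD => /ltW.
Qed.

Lemma grid_point_cube n x : Omega x -> Omega (grid_point n (grid_index n x)).
Proof.
move=> Ox i; have [/andP[-> h] _] := grid_point_itv n i Ox.
by rewrite (le_trans h)//; have /andP[] := Ox i.
Qed.

Lemma cvg_grid_point x : Omega x ->
  grid_point n (grid_index n x) @[n --> \oo] --> x.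
Proof.
move=> Ox; apply/cvg_ballP => e e0.
have := @cvg_harmonic R => /cvgrPdist_lt /(_ _ e0).
apply: filterS => n; rewrite sub0r normrN /harmonic/= ger0_norm ?invr_ge0// => ne.
split=> // i j; rewrite ord1.
have [/andP[h1 h2] h3] := grid_point_itv n j Ox.
rewrite /ball /= ger0_norm ?subr_ge0//.
exact: le_lt_trans h3 ne.
Qed.

Variable f : Rnu * Rnu * Rnu -> R.
Hypothesis cf : forall p, Omega3 p -> f @ within Omega3 (nbhs p) --> f p.

(* [f] is the limit of its values at the grid points, and these approximations take
   countably many values on cells that are measurable. *)
Lemma measurable_continuous_cube : measurable_fun setT (f \_ Omega3).
Proof.
have mO := measurable_cube.
have mO3 : measurable Omega3 by apply: measurableX => //; exact: measurableX.
pose g n (p : Rnu * Rnu * Rnu) :=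
  (grid_index n p.1.1, grid_index n p.1.2, grid_index n p.2).
pose r n p := (grid_point n (g n p).1.1, grid_point n (g n p).1.2, grid_point n (g n p).2).
apply: (@measurable_fun_cvg _ _ _ _ (fun n => (f \o r n) \_ Omega3)).
  move=> n; apply/(measurable_restrictT _ mO3)/measurable_funTS.
  apply: (@measurable_countable_comp _ _ _ _ (g n)
    (fun w => f (grid_point n w.1.1, grid_point n w.1.2, grid_point n w.2))).
  move=> [[w1 w2] w3].
  rewrite (_ : _ @^-1` _ = (grid_index n @^-1` [set w1]) `*`
    (grid_index n @^-1` [set w2]) `*` (grid_index n @^-1` [set w3])).
    apply: measurableX; last exact: measurable_grid_index.
    by apply: measurableX; exact: measurable_grid_index.
  by apply/seteqP; split=> -[[x s] y]; rewrite /preimage /g /=;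
    [move=> [-> -> ->]|move=> [[-> ->] ->]].
move=> p _; have [pO|pO] := pselect (Omega3 p); last first.
  by rewrite patchC ?inE//; under eq_fun do rewrite patchC ?inE//; exact: cvg_cst.
rewrite patchT ?inE//; under eq_fun do rewrite patchT ?inE//.
have rp : r n p @[n --> \oo] --> p.
  move: pO; case: p => -[x s] y [[xO sO] yO].
  exact: (cvg_pair (cvg_pair (cvg_grid_point xO) (cvg_grid_point sO)) (cvg_grid_point yO)).
have rO n : Omega3 (r n p).
  by move: pO => [[? ?] ?]; split; [split|]; exact: grid_point_cube.
move=> V /(cf pO) /= nV.
have : \forall n \near \oo, Omega3 (r n p) -> V (f (r n p)) by exact: rp _ nV.
by apply: filterS => n /(_ (rO n)).
Qed.

Lemma bounded_continuous_cube : exists M, forall p, Omega3 p -> `|f p| <= M.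
Proof.
have cO3 : compact Omega3.
  by apply: compact_setX; [apply: compact_setX|]; exact: compact_cube.
have := continuous_compact ((subspace_continuousP Omega3 f).2 cf) cO3.
move=> /compact_bounded[M [_ MM]]; exists (M + 1) => p Op.
by apply: (MM (M + 1)); [rewrite ltrDl|exists p].
Qed.

End cube.

Lemma eq_cintegral d (T : measurableType d) (R : realType)
    (mu : {measure set T -> \bar R}) (D : set T) (f g : T -> R[i]) :
  (forall x, D x -> f x = g x) -> cintegral mu D f = cintegral mu D g.
Proof.
move=> fg; apply: complexP => /=; apply: eq_Rintegral => x;
  by rewrite inE => Dx; rewrite fg.
Qed.

(** * Transfer between the cube and the finite measure space *)

Section zero_extension.
Context d (T : measurableType d) (R : realType) (A : set T).
Implicit Types f : T -> R[i].

Definition zero_ext f x : R[i] := if x \in A then f x else 0.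

Lemma zero_extE f x : A x -> zero_ext f x = f x.
Proof. by move=> Ax; rewrite /zero_ext mem_set. Qed.

Lemma Re_zero_ext f : (fun x => Re (zero_ext f x)) = (fun x => Re (f x)) \_ A.
Proof. by apply/funext => x; rewrite patchE /zero_ext; case: ifP. Qed.

Lemma Im_zero_ext f : (fun x => Im (zero_ext f x)) = (fun x => Im (f x)) \_ A.
Proof. by apply/funext => x; rewrite patchE /zero_ext; case: ifP. Qed.

Lemma cmeasurable_zero_ext f : measurable A -> cmeasurable_fun A f ->
  cmeasurable_fun setT (zero_ext f).
Proof.
move=> mA [f1 f2]; split.
  by rewrite Re_zero_ext; exact/(measurable_restrictT _ mA).
by rewrite Im_zero_ext; exact/(measurable_restrictT _ mA).
Qed.

End zero_extension.

Section cube_transfer.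
Variables (R : realType) (nu : nat) (a b : R).
Variable k : 'rV[R]_nu -> 'rV[R]_nu -> 'rV[R]_nu -> R[i].
Hypothesis ck : continuous_kernel a b k.
Local Notation Rnu := 'rV[R]_nu.
Local Notation Omega := (cube nu a b).
Local Notation Omega2 := (Omega `*` Omega).
Local Notation Omega3 := (Omega `*` Omega `*` Omega).
Local Notation lam := (@lebesgue_rV R nu).

Definition cube_measure : {finite_measure set Rnu -> \bar R} :=
  mfrestr (@measurable_cube R nu a b) (@cube_lty R nu a b).
Local Notation m := cube_measure.

Lemma cube_measureE A : measurable A -> m A = lam (A `&` Omega).
Proof. by []. Qed.

Lemma measurable_cube2 : measurable Omega2.
Proof. by apply: measurableX; exact: measurable_cube. Qed.

Lemma cube_product_measureE A : measurable A ->
  (m \x m)%E A = (lam \x lam)%E (A `&` Omega2).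
Proof.
move=> mA.
pose n : {measure set (Rnu * Rnu) -> \bar R} := mrestr (lam \x lam)%E measurable_cube2.
apply: (product_measure_unique (m' := n)) => // B C mB mC.
rewrite /n /= /mrestr -setXI product_measure1E; last 2 first.
- by apply: measurableI => //; exact: measurable_cube.
- by apply: measurableI => //; exact: measurable_cube.
by [].
Qed.

Lemma cube_tuple_measureE n A : measurable A ->
  tuple_measure m n A = tuple_measure lam n (A `&` @tuple_set _ Rnu Omega n).
Proof. by apply: tuple_measure_restricted => //; exact: measurable_cube. Qed.

Definition kernel0 x s y : R[i] := zero_ext Omega3 (fun p => k p.1.1 p.1.2 p.2) (x, s, y).

Let ck' p : Omega3 p ->
  (fun p : Rnu * Rnu * Rnu => k p.1.1 p.1.2 p.2 : R[i]^o) @ within Omega3 (nbhs p) -->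
  (k p.1.1 p.1.2 p.2 : R[i]^o).
Proof. by move=> Op; exact: ((subspace_continuousP _ _).1 ck p Op). Qed.

Lemma cmeasurable_kernel0 :
  cmeasurable_fun setT (fun p : Rnu * Rnu * Rnu => kernel0 p.1.1 p.1.2 p.2).
Proof.
have -> : (fun p : Rnu * Rnu * Rnu => kernel0 p.1.1 p.1.2 p.2) =
    zero_ext Omega3 (fun p => k p.1.1 p.1.2 p.2).
  by apply/funext => -[[]].
split.
  rewrite Re_zero_ext; apply: measurable_continuous_cube => p /ck'.
  exact: cvg_Re.
rewrite Im_zero_ext; apply: measurable_continuous_cube => p /ck'.
exact: cvg_Im.
Qed.

Lemma bounded_kernel0 : exists2 M, 0 <= M & forall x s y, normc (kernel0 x s y) <= M.
Proof.
have [M1 h1] : exists M, forall p, Omega3 p -> `|Re (k p.1.1 p.1.2 p.2)| <= M.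
  by apply: bounded_continuous_cube => p /ck'; exact: cvg_Re.
have [M2 h2] : exists M, forall p, Omega3 p -> `|Im (k p.1.1 p.1.2 p.2)| <= M.
  by apply: bounded_continuous_cube => p /ck'; exact: cvg_Im.
exists (`|M1| + `|M2|) => [|x s y]; first exact: addr_ge0.
rewrite /kernel0 /zero_ext; case: ifPn => [|_]; last by rewrite Normc.normc0 addr_ge0.
rewrite inE => O; rewrite (le_trans (normc_le_ReIm _))// lerD//.
  exact: le_trans (h1 _ O) (ler_norm _).
exact: le_trans (h2 _ O) (ler_norm _).
Qed.

Lemma kernel0E x s y : Omega x -> Omega s -> Omega y -> kernel0 x s y = k x s y.
Proof. by move=> Ox Os Oy; rewrite /kernel0 zero_extE. Qed.

Lemma D1E y kappa : Omega y ->
  D1 a b k y kappa = fredholm_det m setT (fun x s => kernel0 x s y) kappa.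
Proof.
move=> Oy; apply: (@eq_fredholm_det _ _ _ lam m Omega setT
  (fun x s => k x s y) (fun x s => kernel0 x s y)) => n.
rewrite tuple_set_setT.
rewrite [RHS](cintegral_restricted (mu := tuple_measure lam n)
  (measurable_tuple_set (n := n) (@measurable_cube R nu a b))
  (@cube_tuple_measureE n)); last first.
  by apply: (cmeasurable_det_kernel_mx cmeasurable_kernel0 (w := fun=> y)).
apply: eq_cintegral => t Ot; apply: (congr1 determinant).
by apply/matrixP => i j; rewrite !mxE kernel0E.
Qed.

Lemma M1E x s y kappa : Omega x -> Omega s -> Omega y ->
  M1 a b k x s y kappa = fredholm_minor m setT (fun x s => kernel0 x s y) x s kappa.
Proof.
move=> Ox Os Oy; apply: (@eq_fredholm_minor _ _ _ lam m Omega setT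
  (fun x s => k x s y) (fun x s => kernel0 x s y)) => [|n]; first by rewrite kernel0E.
rewrite tuple_set_setT.
rewrite [RHS](cintegral_restricted (mu := tuple_measure lam n)
  (measurable_tuple_set (n := n) (@measurable_cube R nu a b))
  (@cube_tuple_measureE n)); last first.
  have mt z : measurable_fun setT (fun t : n.-tuple Rnu => tcons (z, t)).
    by apply: (measurableT_comp (@measurable_tcons _ Rnu n)); exact: measurable_fun_pair.
  exact: (cmeasurable_det_kernel_mx cmeasurable_kernel0 (mt x) (mt s) (w := fun=> y)).
apply: eq_cintegral => t Ot; apply: (congr1 determinant).
have Oc z i : Omega z -> Omega (tnth (tcons (z, t)) i).
  by move=> Oz; case: (unliftP ord0 i) => [i' ->|->]; rewrite ?tnthS ?tnth0.
apply/matrixP => i j; rewrite !mxE kernel0E//; exact: Oc.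
Qed.

(** Nothing is known of [f] off the cube; [f'] is any globally measurable function agreeing with it
    there. Leaving [f'] free covers both zero extensions and the explicit solution built from
    one. *)
Lemma T1E f f' p : Omega2 p -> cmeasurable_fun setT f' ->
  (forall q, Omega2 q -> f q = f' q) ->
  T1 a b k f p = cintegral m setT (fun s => kernel0 p.1 s p.2 * f' (s, p.2)).
Proof.
move=> [Op1 Op2] mf' ff'.
rewrite (cintegral_restricted (mu := lam) (@measurable_cube R nu a b) cube_measureE).
  by apply: eq_cintegral => s Os; rewrite kernel0E// ff'.
apply: cmeasurableM; last exact: cmeasurable_section_l.
apply: (cmeasurable_comp (g := fun s => (p.1, s, p.2)) cmeasurable_kernel0).
by apply: measurable_fun_pair => //; exact: measurable_fun_pair.
Qed.

Lemma resolvent_opE kappa g g' p : Omega2 p -> cmeasurable_fun setT g' ->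
  (forall q, Omega2 q -> g q = g' q) ->
  resolvent_op a b k kappa g p = cintegral m setT (fun s =>
    fredholm_minor m setT (fun x s => kernel0 x s p.2) p.1 s kappa /
    fredholm_det m setT (fun x s => kernel0 x s p.2) kappa * g' (s, p.2)).
Proof.
move=> [Op1 Op2] mg' gg'.
rewrite (cintegral_restricted (mu := lam) (@measurable_cube R nu a b) cube_measureE).
  by apply: eq_cintegral => s Os; rewrite M1E// D1E// gg'.
have [M M0 kM] := bounded_kernel0.
have [BN [_ mD mM _ _]] := fredholm_theory m kappa cmeasurable_kernel0 kM M0.
apply: cmeasurableM; last exact: cmeasurable_section_l.
apply: cmeasurableM; last exact: cmeasurable_cst.
apply: (cmeasurable_comp (g := fun s => (p.1, s, p.2)) mM).
by apply: measurable_fun_pair => //; exact: measurable_fun_pair.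
Qed.

Lemma integral_cube2 (f f' : Rnu * Rnu -> R[i]) : cmeasurable_fun setT f' ->
  (forall q, Omega2 q -> f q = f' q) ->
  (\int[m \x m]_p sqnorm (f' p) = \int[lam \x lam]_(p in Omega2) sqnorm (f p))%E.
Proof.
move=> mf' ff'.
rewrite (integral_restricted (mu := (lam \x lam)%E) measurable_cube2 cube_product_measureE).
  by apply: eq_integral => p; rewrite inE => Op; rewrite ff'.
exact: measurable_sqnorm.
Qed.

Lemma inH_zero_ext g : inH a b g -> cmeasurable_fun setT (zero_ext Omega2 g) /\
  (\int[m \x m]_p sqnorm (zero_ext Omega2 g p) < +oo)%E.
Proof.
move=> [mg goo]; have mg' := cmeasurable_zero_ext measurable_cube2 mg.
split=> //; rewrite (integral_cube2 (f := g))// => q Oq.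
by rewrite zero_extE.
Qed.

Lemma inH_eq f f' : cmeasurable_fun setT f' ->
  (\int[m \x m]_p sqnorm (f' p) < +oo)%E ->
  (forall q, Omega2 q -> f q = f' q) -> inH a b f.
Proof.
move=> mf' f'oo ff'; split; last by rewrite -(integral_cube2 mf').
split; (apply: eq_measurable_fun; last apply: measurable_funTS);
  [|exact: mf'.1| |exact: mf'.2]; by move=> q; rewrite inE => Oq; rewrite ff'.
Qed.

Lemma ae_cube2 (P : Rnu * Rnu -> Prop) : {ae (m \x m)%E, forall p, P p} <->
  {ae (lam \x lam)%E, forall p, Omega2 p -> P p}.
Proof. exact: (ae_restricted measurable_cube2 cube_product_measureE). Qed.

Lemma ae_solution kappa g h : inH a b h ->
  ae_eqH a b (fun p => h p - kappa * T1 a b k h p) g ->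
  {ae (m \x m)%E, forall p, zero_ext Omega2 h p -
    kappa * cintegral m setT (fun s => kernel0 p.1 s p.2 * zero_ext Omega2 h (s, p.2)) =
    zero_ext Omega2 g p}.
Proof.
move=> /inH_zero_ext[mh _] hE; apply/ae_cube2; apply: filterS hE => p + Op.
rewrite !zero_extE// => /(_ Op) <-; congr (_ - _ * _).
by rewrite (T1E Op mh)// => q Oq; rewrite zero_extE.
Qed.

(** The zero set of the determinant within the cube is measurable; were its measure positive, it
    would itself witness that [kappa] is characteristic. *)
Lemma essential_number_ae kappa : essential_numbers a b k kappa ->
  {ae m, forall y, fredholm_det m setT (fun x s => kernel0 x s y) kappa != 0}.
Proof.
move=> [_ nchar].
have [M M0 kM] := bounded_kernel0.
have [BN [_ mD _ _ _]] := fredholm_theory m kappa cmeasurable_kernel0 kM M0.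
set Dv := fun y => fredholm_det _ _ _ _ in mD.
have mZ : measurable [set y | Dv y = 0].
  have mn := measurable_sqr_normc mD.
  rewrite (_ : [set y | _] = (fun y => normc (Dv y) ^+ 2) @^-1` [set 0]).
    by rewrite -[X in measurable X]setTI; apply: mn.
  apply/seteqP; split=> y /=; first by move=> ->; rewrite Normc.normc0 expr0n.
  by move=> /eqP; rewrite sqrf_eq0 normc_eq0 => /eqP.
have mO := @measurable_cube R nu a b.
exists [set y | Dv y = 0]; split=> //; last first.
  by move=> y /= /negP; rewrite negbK => /eqP.
rewrite cube_measureE//; apply/eqP; rewrite eq_le measure_ge0 andbT leNgt.
apply/negP => pos; apply: nchar; exists ([set y | Dv y = 0] `&` Omega); split=> //.
- exact: measurableI.
- by move=> y [Dy Oy]; rewrite D1E.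
Qed.

End cube_transfer.

Theorem theorem4 (R : realType) (nu : nat) (a b : R)
    (k : 'rV[R]_nu -> 'rV[R]_nu -> 'rV[R]_nu -> R[i]) (kappa0 : R[i])
    (g0 : 'rV[R]_nu * 'rV[R]_nu -> R[i]) :
  (1 <= nu)%N -> a < b -> continuous_kernel a b k ->
  essential_numbers a b k kappa0 ->
  inH a b g0 ->
  (\int[lebesgue_rV]_(y in cube nu a b)
     ((\int[lebesgue_rV]_(s in cube nu a b) sqnorm (g0 (s, y)))
        / sqnorm (D1 a b k y kappa0)) < +oo)%E ->
  let f := fun p => g0 p + kappa0 * resolvent_op a b k kappa0 g0 p in
  [/\ is_solution a b k kappa0 g0 f,
      (forall h, is_solution a b k kappa0 g0 h -> ae_eqH a b h f) &
      (forall h, is_solution a b k kappa0 (fun=> 0) h ->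
         ae_eqH a b h (fun=> 0))].
Proof.
move=> _ _ ck ess Hg0 hoo f.
have [M M0 kM] := bounded_kernel0 ck.
have mk := cmeasurable_kernel0 ck.
have D0 := essential_number_ae ck ess.
pose Om2 := cube nu a b `*` cube nu a b.
have [mg goo] := inH_zero_ext Hg0.
set g := zero_ext _ g0 in mg goo.
have gE q : Om2 q -> g0 q = g q by move=> Oq; rewrite /g zero_extE.
have woo : (\int[cube_measure nu a b]_y
    ((\int[cube_measure nu a b]_s sqnorm (g (s, y))) / sqnorm (fredholm_det
      (cube_measure nu a b) setT (fun x s => kernel0 a b k x s y) kappa0)) < +oo)%E.
  rewrite (integral_restricted (mu := lebesgue_rV) (@measurable_cube R nu a b)
    (@cube_measureE _ nu a b)); last first.
    exact: (@measurable_weight _ _ _ (cube_measure nu a b) kappa0 M _ mk kM M0 g mg).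
  apply: le_lt_trans hoo; rewrite le_eqVlt; apply/orP; left; apply/eqP.
  apply: eq_integral => y; rewrite inE => Oy; rewrite D1E//.
  apply: (congr1 (fun z => z / _)%E).
  rewrite (integral_restricted (mu := lebesgue_rV) (@measurable_cube R nu a b)
    (@cube_measureE _ nu a b)).
    by apply: eq_integral => s; rewrite inE => Os; rewrite gE.
  by apply: measurable_sqnorm; exact: cmeasurable_section_l.
have [] := partial_integral_solution mk kM M0 D0 mg goo woo.
set f' := fun p => g p + _ => mf' f'oo f'E.
(* [f] is built from [g0] and [f'] from its zero extension; they need to agree on the cube only. *)
have fE q : Om2 q -> f q = f' q.
  by move=> Oq; rewrite /f /f' (resolvent_opE ck kappa0 Oq mg gE) gE.
have Hf : inH a b f by exact: inH_eq mf' f'oo fE.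
have fsol : ae_eqH a b (fun p => f p - kappa0 * T1 a b k f p) g0.
  have := (ae_cube2 a b _).1 f'E; apply: filterS => p /[swap] Op /(_ Op) e.
  by rewrite (T1E ck Op mf' fE) fE// e gE.
split=> //.
- move=> h [Hh hE]; have [mh hoo'] := inH_zero_ext Hh.
  have hE' := ae_solution ck Hh hE.
  have := partial_integral_injective mk kM M0 D0 mf' mh f'oo hoo' f'E hE'.
  move/(ae_cube2 a b _).1; apply: filterS => p /[swap] Op /(_ Op).
  by rewrite zero_extE// fE.
- move=> h [Hh hE]; have [mh hoo'] := inH_zero_ext Hh.
  have := ae_solution ck Hh hE.
  have z0 p : zero_ext Om2 (fun=> 0 : R[i]) p = 0 by rewrite /zero_ext; case: ifP.
  move=> hE'; have := partial_integral_unique mk kM M0 D0 mh hoo' _.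
  have {}hE' := filterS _ hE'.
  have : {ae (cube_measure nu a b \x cube_measure nu a b)%E, forall p,
      zero_ext Om2 h p - kappa0 * cintegral (cube_measure nu a b) setT
        (fun s => kernel0 a b k p.1 s p.2 * zero_ext Om2 h (s, p.2)) = 0}.
    by apply: hE' => p ->; rewrite z0.
  move=> h0 /(_ h0) /(ae_cube2 a b _).1; apply: filterS => p /[swap] Op /(_ Op).
  by rewrite zero_extE.
Qed.
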